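(* Let $n\ge 1$ be an integer and $0\le\alpha<1$. The $\mathcal{SL}_n$-radius for the class $\mathcal{CS}_n(\alpha)$ is given by $$R_{\mathcal{SL}_n}(\mathcal{CS}_n(\alpha))=\left(\frac{\sqrt{2}-1}{(1+n-\alpha)+\sqrt{(1+n-\alpha)^2+(1-2\alpha+\sqrt2)(\sqrt2-1)}}\right)^{1/n}.$$ This radius is sharp (it cannot be replaced by a larger number).
   Context: $\mathbb{D}=\{z\in\mathbb{C}:|z|<1\}$, $\mathbb{D}_r=\{z\in\mathbb{C}:|z|<r\}$. For an integer $n\ge1$, $\mathcal{A}_n$ is the class of analytic functions on $\mathbb{D}$ of the form $f(z)=z+\sum_{k\ge n+1}a_kz^k$. $\mathcal{P}_n$ is the class of analytic functions $p(z)=1+c_nz^n+c_{n+1}z^{n+1}+\cdots$ on $\mathbb{D}$ with $\operatorname{Re}p(z)>0$ for all $z\in\mathbb{D}$. For $0\le\alpha<1$, $\mathcal{ST}_n(\alpha)$ is the class of $g\in\mathcal{A}_n$ that are starlike of order $\alpha$, i.e. $zg'(z)/g(z)$ is analytic in $\mathbb{D}$ and subordinate to $(1+(1-2\alpha)z)/(1-z)$, equivalently $\operatorname{Re}(zg'(z)/g(z))>\alpha$ in $\mathbb{D}$. $\mathcal{CS}_n(\alpha)$ (close-to-starlike functions of type $\alpha$) is the class of $f\in\mathcal{A}_n$ for which there exists $g\in\mathcal{ST}_n(\alpha)$ with $f/g\in\mathcal{P}_n$. $\mathcal{SL}_n$ is the class of $f\in\mathcal{A}_n$ such that $\left|\left(zf'(z)/f(z)\right)^2-1\right|<1$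 for all $z\in\mathbb{D}$ (with $zf'(z)/f(z)$ taken to be $1$ at $z=0$). For a class $\mathcal{M}\subset\mathcal{A}_n$, the $\mathcal{SL}_n$-radius $R_{\mathcal{SL}_n}(\mathcal{M})$ is the largest number $R\in(0,1]$ such that for every $f\in\mathcal{M}$ and every $r<R$ one has $\left|\left(zf'(z)/f(z)\right)^2-1\right|<1$ for all $z\in\mathbb{D}_r$. *)

(* Defs.v *)
From Stdlib Require Import Reals.
From Coquelicot Require Import Coquelicot.
Open Scope R_scope.

Definition disk (r : R) (z : C) : Prop := Cmod z < r.

Definition analytic_on (U : C -> Prop) (f : C -> C) : Prop :=
  forall z0 : C, U z0 ->
  exists (a : nat -> C) (eps : posreal),
  forall z : C, Cmod (z - z0)%C < eps -> is_pseries a (z - z0)%C (f z).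

(* Functions are total on C; only their values on the unit disk matter. *)
Definition class_A (n : nat) (f : C -> C) : Prop :=
  analytic_on (disk 1) f /\
  exists a : nat -> C,
    a 0%nat = RtoC 0 /\ a 1%nat = RtoC 1 /\
    (forall k : nat, (2 <= k <= n)%nat -> a k = RtoC 0) /\
    (forall z : C, disk 1 z -> is_pseries a z (f z)).

Definition class_P (n : nat) (p : C -> C) : Prop :=
  analytic_on (disk 1) p /\
  (exists c : nat -> C,
    c 0%nat = RtoC 1 /\
    (forall k : nat, (1 <= k < n)%nat -> c k = RtoC 0) /\
    (forall z : C, disk 1 z -> is_pseries c z (p z))) /\
  (forall z : C, disk 1 z -> 0 < Re (p z)).

(* The quotients z f'/f and f/g below, for f and g in [class_A], have a removable
   singularity at the origin, where their limit is 1. *)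
Definition fill1 (q : C -> C) (z : C) : C :=
  if Ceq_dec z (RtoC 0) then RtoC 1 else q z.

Definition zlogder (f : C -> C) : C -> C :=
  fill1 (fun z => (z * C_derive f z / f z)%C).

Definition subordinate (f F : C -> C) : Prop :=
  exists w : C -> C,
    analytic_on (disk 1) w /\ w (RtoC 0) = RtoC 0 /\
    (forall z : C, disk 1 z -> Cmod (w z) < 1) /\
    (forall z : C, disk 1 z -> f z = F (w z)).

(* The zero-freeness condition makes the quotient z g'/g meaningful, inversion
   being total in Coquelicot. *)
Definition class_ST (n : nat) (alpha : R) (g : C -> C) : Prop :=
  class_A n g /\
  (forall z : C, disk 1 z -> z <> RtoC 0 -> g z <> RtoC 0) /\
  analytic_on (disk 1) (zlogder g) /\
  subordinate (zlogder g)
    (fun z => ((1 + RtoC (1 - 2 * alpha) * z) / (1 - z))%C).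

Definition class_CS (n : nat) (alpha : R) (f : C -> C) : Prop :=
  class_A n f /\
  exists g : C -> C,
    class_ST n alpha g /\ class_P n (fill1 (fun z => (f z / g z)%C)).

(* At a zero z <> 0 of f the quotient z f'/f is undefined; as [Cinv 0] is 0,
   [zlogder f z] is then 0 and the inequality is false, as it should be. *)
Definition SL_at (f : C -> C) (z : C) : Prop :=
  Cmod (zlogder f z ^ 2 - 1)%C < 1.

Definition SL_admissible (M : (C -> C) -> Prop) (R0 : R) : Prop :=
  0 < R0 <= 1 /\
  forall f : C -> C, M f ->
  forall r : R, r < R0 -> forall z : C, disk r z -> SL_at f z.

Definition is_SL_radius (M : (C -> C) -> Prop) (R0 : R) : Prop :=
  SL_admissible M R0 /\
  forall R1 : R, SL_admissible M R1 -> R1 <= R0.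

(* Main.v *)
Require Import Defs.
From Stdlib Require Import Reals Lra Lia Classical ClassicalEpsilon List.
From Coquelicot Require Import Coquelicot.
Open Scope R_scope.

(** Write f = g p with g starlike of order alpha and p of positive real part,
    and put x = |z|^n.  Then z f'/f = z g'/g + z p'/p.

    The function q = z g'/g takes the value 1 to order n at the origin and maps
    the disk into the half-plane Re > alpha, so the Schwarz lemma of order n,
    applied to (q - 1)/(q + 1 - 2 alpha), puts q(z) in the disk with centre
    a = (1 + (1 - 2 alpha) x^2)/(1 - x^2) and radius 2 (1 - alpha) x/(1 - x^2)
    ([class_ST_bound], [apollonius_disk]).  The Schwarz lemma together with the
    Schwarz-Pick inequality, applied to (p - 1)/(z^n (p + 1)), bounds z p'/p by
    2 n x/(1 - x^2) ([class_P_logder_bound]).  Hence z f'/f lies in the disk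
    with centre a and radius 2 (1 + n - alpha) x/(1 - x^2)
    ([class_CS_zlogder_disk]).  As a >= 1, this disk lies inside the right loop
    of the lemniscate |W^2 - 1| < 1 as soon as its rightmost point is to the
    left of sqrt 2 ([disk_in_lemniscate]).  That condition is a quadratic
    inequality in x, and the radius in the statement is the n-th root of its
    positive zero ([root_value_spec]).

    For sharpness take g = z (1 - z^n)^(-b) with b = 2 (1 - alpha)/n and
    p = (1 + z^n)/(1 - z^n): at the positive point of modulus equal to the
    radius all the estimates above are equalities, and z f'/f is exactly sqrt 2
    ([extremal_close_zlogder]).

    The function theory rests on power series, without integrals.  A function
    analytic on a set and vanishing at one of its points can be divided by the
    corresponding linear factor, the quotient again being analytic
    ([analytic_divide]); it follows that analytic functions are differentiable
    and that zeros can be removed.  Comparing leading terms shows that the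
    modulus of a quotient N/M of analytic functions has no local maximum unless
    the quotient is locally constant, and compactness of closed disks turns this
    into the maximum principle ([quotient_maximum_principle]), from which the
    lemmas of Schwarz and Pick follow.  All of them are stated for pairs N, M
    instead of quotients: only linear combinations of N and M, multiplied by
    polynomials in z, then have to be analytic, and neither products nor
    inverses of power series occur.  The extremal functions are given by
    binomial series; their local expansions come from re-expanding a power
    series at another point of its disk ([pseries_reexpansion]). *)

Notation is_cpseries := (is_pseries (K := C_AbsRing) (V := C_NormedModule)).
Notation is_cseries := (is_series (K := C_AbsRing) (V := C_NormedModule)).

(** * Continuity and derivatives of functions of a complex variable *)

Definition Ccontinuous (f : C -> C) (z0 : C) : Prop :=
  forall eps : R, 0 < eps -> exists delta : R, 0 < delta /\
  forall z : C, Cmod (z - z0) < delta -> Cmod (f z - f z0) < eps.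

Lemma Cmod_sub_sym (x y : C) : Cmod (x - y) = Cmod (y - x).
Proof. rewrite <- Cmod_opp. f_equal. ring. Qed.

Lemma Cmod_triangle_sub (x y : C) : Cmod x <= Cmod (x - y) + Cmod y.
Proof.
  replace x with ((x - y) + y)%C at 1 by ring. apply Cmod_triangle.
Qed.

Lemma Ccontinuous_const (c z0 : C) : Ccontinuous (fun _ => c) z0.
Proof.
  intros eps Heps. exists 1. split; [lra|]. intros z _.
  replace (c - c)%C with (RtoC 0) by ring. rewrite Cmod_0. lra.
Qed.

Lemma Ccontinuous_id (z0 : C) : Ccontinuous (fun z => z) z0.
Proof. intros eps Heps. exists eps. split; [lra|]. auto. Qed.

Lemma Ccontinuous_plus (f g : C -> C) (z0 : C) :
  Ccontinuous f z0 -> Ccontinuous g z0 -> Ccontinuous (fun z => f z + g z)%C z0.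
Proof.
  intros Hf Hg eps Heps.
  destruct (Hf (eps / 2)) as (d1 & Hd1 & H1); [lra|].
  destruct (Hg (eps / 2)) as (d2 & Hd2 & H2); [lra|].
  exists (Rmin d1 d2). split; [apply Rmin_pos; auto|].
  intros z Hz.
  specialize (H1 z (Rlt_le_trans _ _ _ Hz (Rmin_l _ _))).
  specialize (H2 z (Rlt_le_trans _ _ _ Hz (Rmin_r _ _))).
  replace (f z + g z - (f z0 + g z0))%C
    with ((f z - f z0) + (g z - g z0))%C by ring.
  pose proof (Cmod_triangle (f z - f z0) (g z - g z0)). lra.
Qed.

Lemma Ccontinuous_bounded (f : C -> C) (z0 : C) :
  Ccontinuous f z0 -> exists delta : R, 0 < delta /\
  forall z : C, Cmod (z - z0) < delta -> Cmod (f z) <= Cmod (f z0) + 1.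
Proof.
  intros Hf. destruct (Hf 1) as (d & Hd & H); [lra|].
  exists d. split; auto. intros z Hz. specialize (H z Hz).
  pose proof (Cmod_triangle_sub (f z) (f z0)). lra.
Qed.

Lemma Ccontinuous_mult (f g : C -> C) (z0 : C) :
  Ccontinuous f z0 -> Ccontinuous g z0 -> Ccontinuous (fun z => f z * g z)%C z0.
Proof.
  intros Hf Hg eps Heps.
  destruct (Ccontinuous_bounded f z0 Hf) as (d3 & Hd3 & H3).
  pose proof (Cmod_ge_0 (f z0)) as Pf. pose proof (Cmod_ge_0 (g z0)) as Pg.
  destruct (Hf (eps / 2 / (Cmod (g z0) + 1))) as (d1 & Hd1 & H1).
  { repeat apply Rdiv_lt_0_compat; lra. }
  destruct (Hg (eps / 2 / (Cmod (f z0) + 1))) as (d2 & Hd2 & H2).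
  { repeat apply Rdiv_lt_0_compat; lra. }
  exists (Rmin d3 (Rmin d1 d2)). split; [repeat apply Rmin_pos; auto|].
  intros z Hz.
  apply Rmin_Rgt in Hz as [Hz3 Hz]. apply Rmin_Rgt in Hz as [Hz1 Hz2].
  specialize (H1 z Hz1). specialize (H2 z Hz2). specialize (H3 z Hz3).
  replace (f z * g z - f z0 * g z0)%C
    with (f z * (g z - g z0) + (f z - f z0) * g z0)%C by ring.
  eapply Rle_lt_trans; [apply Cmod_triangle|]. rewrite !Cmod_mult.
  assert (A : Cmod (f z) * Cmod (g z - g z0) < eps / 2).
  { apply Rle_lt_trans with ((Cmod (f z0) + 1) * Cmod (g z - g z0)).
    - apply Rmult_le_compat_r; [apply Cmod_ge_0 | exact H3].
    - apply Rlt_le_trans with ((Cmod (f z0) + 1) * (eps / 2 / (Cmod (f z0) + 1))).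
      + apply Rmult_lt_compat_l; lra.
      + right. field. lra. }
  assert (B : Cmod (f z - f z0) * Cmod (g z0) <= eps / 2).
  { apply Rle_trans with (eps / 2 / (Cmod (g z0) + 1) * (Cmod (g z0) + 1)).
    - apply Rmult_le_compat; try apply Cmod_ge_0; lra.
    - right. field. lra. }
  lra.
Qed.

Lemma Ccontinuous_inv (f : C -> C) (z0 : C) :
  Ccontinuous f z0 -> f z0 <> RtoC 0 -> Ccontinuous (fun z => / f z)%C z0.
Proof.
  intros Hf H0 eps Heps.
  assert (P0 : 0 < Cmod (f z0)) by (apply Cmod_gt_0; auto).
  set (c := Cmod (f z0)) in *.
  destruct (Hf (Rmin (c / 2) (eps * c * c / 2))) as (d & Hd & H).
  { apply Rmin_pos; [lra|]. apply Rdiv_lt_0_compat; [|lra].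
    repeat apply Rmult_lt_0_compat; lra. }
  exists d. split; auto. intros z Hz. specialize (H z Hz).
  apply Rmin_Rgt in H as [Ha Hb].
  assert (Pz : c / 2 < Cmod (f z)).
  { pose proof (Cmod_triangle_sub (f z0) (f z)) as T.
    rewrite Cmod_sub_sym in T. fold c in T. lra. }
  assert (Nz : f z <> RtoC 0) by (apply Cmod_gt_0; lra).
  replace (/ f z - / f z0)%C with (- ((f z - f z0) / (f z * f z0)))%C
    by (field; auto).
  rewrite Cmod_opp, Cmod_div, Cmod_mult by (apply Cmult_neq_0; auto).
  fold c. apply Rmult_lt_reg_r with (Cmod (f z) * c).
  { apply Rmult_lt_0_compat; lra. }
  unfold Rdiv. rewrite Rmult_assoc, Rinv_l, Rmult_1_r.
  2:{ apply Rgt_not_eq, Rmult_lt_0_compat; lra. }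
  apply Rlt_le_trans with (eps * c * c / 2); [lra|].
  apply Rle_trans with (eps * c * (c / 2)); [right; field|].
  rewrite (Rmult_comm (Cmod (f z))), <- Rmult_assoc.
  apply Rmult_le_compat_l; [|lra]. apply Rlt_le, Rmult_lt_0_compat; lra.
Qed.

Lemma Ccontinuous_comp (f g : C -> C) (z0 : C) :
  Ccontinuous g z0 -> Ccontinuous f (g z0) -> Ccontinuous (fun z => f (g z)) z0.
Proof.
  intros Hg Hf eps Heps. destruct (Hf eps Heps) as (d & Hd & H).
  destruct (Hg d Hd) as (e & He & H'). exists e. split; auto.
Qed.

Lemma Ccontinuous_ext_loc (f g : C -> C) (z0 : C) (r : R) :
  0 < r -> (forall z, Cmod (z - z0) < r -> f z = g z) ->
  Ccontinuous f z0 -> Ccontinuous g z0.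
Proof.
  intros Hr E Hf eps Heps. destruct (Hf eps Heps) as (d & Hd & H).
  exists (Rmin d r). split; [apply Rmin_pos; auto|].
  intros z Hz. apply Rmin_Rgt in Hz as [H1 H2].
  rewrite <- !E; auto.
  replace (z0 - z0)%C with (RtoC 0) by ring. rewrite Cmod_0. lra.
Qed.

Lemma Ccontinuous_neq0 (f : C -> C) (z0 : C) :
  Ccontinuous f z0 -> f z0 <> RtoC 0 -> exists delta : R, 0 < delta /\
  forall z, Cmod (z - z0) < delta -> f z <> RtoC 0.
Proof.
  intros Hf H0. destruct (Hf (Cmod (f z0))) as (d & Hd & H).
  { apply Cmod_gt_0; auto. }
  exists d. split; auto. intros z Hz E. specialize (H z Hz).
  rewrite E, Cmod_sub_sym in H.
  replace (f z0 - 0)%C with (f z0) in H by ring. lra.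
Qed.

(** Carathéodory's form of the complex derivative: the difference quotient
    extends continuously to [z0].  Sums, products and compositions become
    algebraic identities between such extensions. *)
Definition is_Cderive (f : C -> C) (z0 d : C) : Prop :=
  exists K : C -> C, Ccontinuous K z0 /\ K z0 = d /\
  forall z : C, (f z - f z0 = (z - z0) * K z)%C.

Lemma is_Cderive_const (c z0 : C) : is_Cderive (fun _ => c) z0 (RtoC 0).
Proof.
  exists (fun _ => RtoC 0). split; [apply Ccontinuous_const|].
  split; auto. intros z. ring.
Qed.

Lemma is_Cderive_id (z0 : C) : is_Cderive (fun z => z) z0 (RtoC 1).
Proof.
  exists (fun _ => RtoC 1). split; [apply Ccontinuous_const|].
  split; auto. intros z. ring.
Qed.

Lemma is_Cderive_plus (f g : C -> C) (z0 df dg : C) :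
  is_Cderive f z0 df -> is_Cderive g z0 dg -> is_Cderive (fun z => f z + g z)%C z0 (df + dg)%C.
Proof.
  intros (K & HK & EK & HfK) (L & HL & EL & HgL).
  exists (fun z => K z + L z)%C. split; [apply Ccontinuous_plus; auto|].
  split; [congruence|]. intros z.
  transitivity ((f z - f z0) + (g z - g z0))%C; [ring|].
  rewrite HfK, HgL. ring.
Qed.

Lemma is_Cderive_cont (f : C -> C) (z0 d : C) : is_Cderive f z0 d -> Ccontinuous f z0.
Proof.
  intros (K & HK & EK & H).
  apply Ccontinuous_ext_loc with (fun z => f z0 + (z + (- z0)) * K z)%C 1; [lra| |].
  { intros z _. transitivity (f z0 + (f z - f z0))%C; [|ring].
    rewrite H. ring. }
  apply Ccontinuous_plus; [apply Ccontinuous_const|]. apply Ccontinuous_mult; auto.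
  apply Ccontinuous_plus; [apply Ccontinuous_id|apply Ccontinuous_const].
Qed.

Lemma is_Cderive_mult (f g : C -> C) (z0 df dg : C) :
  is_Cderive f z0 df -> is_Cderive g z0 dg ->
  is_Cderive (fun z => f z * g z)%C z0 (df * g z0 + f z0 * dg)%C.
Proof.
  intros Hf Hg. pose proof (is_Cderive_cont g z0 dg Hg) as Cg.
  destruct Hf as (K & HK & EK & HfK). destruct Hg as (L & HL & EL & HgL).
  exists (fun z => K z * g z + f z0 * L z)%C.
  split.
  { apply Ccontinuous_plus; apply Ccontinuous_mult; auto. apply Ccontinuous_const. }
  split; [congruence|]. intros z.
  transitivity ((f z - f z0) * g z + f z0 * (g z - g z0))%C; [ring|].
  rewrite HfK, HgL. ring.
Qed.

Lemma is_Cderive_comp (f g : C -> C) (z0 df dg : C) :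
  is_Cderive g z0 dg -> is_Cderive f (g z0) df -> is_Cderive (fun z => f (g z)) z0 (df * dg)%C.
Proof.
  intros Hg Hf. pose proof (is_Cderive_cont g z0 dg Hg) as Cg.
  destruct Hf as (K & HK & EK & HfK). destruct Hg as (L & HL & EL & HgL).
  exists (fun z => K (g z) * L z)%C. split.
  { apply Ccontinuous_mult; auto. apply (Ccontinuous_comp K g z0); auto. }
  split; [congruence|]. intros z. rewrite HfK, HgL. ring.
Qed.

Lemma is_Cderive_pow (z0 : C) (n : nat) :
  is_Cderive (fun z => z ^ n)%C z0 (RtoC (INR n) * z0 ^ (pred n))%C.
Proof.
  induction n as [|n IH].
  { simpl. replace (RtoC 0 * 1)%C with (RtoC 0) by ring. apply is_Cderive_const. }
  pose proof (is_Cderive_mult (fun z => z) (fun z => z ^ n)%C z0 _ _ (is_Cderive_id z0) IH) as H.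
  replace (RtoC (INR (S n)) * z0 ^ pred (S n))%C
    with (1 * z0 ^ n + z0 * (INR n * z0 ^ Nat.pred n))%C; [exact H|].
  rewrite S_INR, RtoC_plus. destruct n; simpl pred; [simpl; ring|].
  rewrite (Cpow_S z0 n). ring.
Qed.

Lemma is_Cderive_ext_loc (f g : C -> C) (z0 d : C) (r : R) :
  0 < r -> (forall z, Cmod (z - z0) < r -> f z = g z) ->
  is_Cderive f z0 d -> is_Cderive g z0 d.
Proof.
  intros Hr E (K & HK & EK & H).
  assert (Ez0 : f z0 = g z0).
  { apply E. replace (z0 - z0)%C with (RtoC 0) by ring. rewrite Cmod_0. lra. }
  exists (fun z => if Ceq_dec z z0 then d else (g z - g z0) / (z - z0))%C.
  split; [|split].
  - apply Ccontinuous_ext_loc with K r; auto. intros z Hz.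
    destruct (Ceq_dec z z0) as [->|N]; auto.
    rewrite <- E, <- Ez0, H by auto. field.
    intros A. apply N. apply Ceq_minus; auto.
  - destruct (Ceq_dec z0 z0); congruence.
  - intros z. destruct (Ceq_dec z z0) as [->|N]; [ring|]. field.
    intros A. apply N. apply Ceq_minus; auto.
Qed.

Lemma Ccontinuous_unique (f g : C -> C) (z0 : C) (r : R) :
  0 < r -> (forall z, z <> z0 -> Cmod (z - z0) < r -> f z = g z) ->
  Ccontinuous f z0 -> Ccontinuous g z0 -> f z0 = g z0.
Proof.
  intros Hr E Hf Hg. apply NNPP. intros N.
  assert (P : 0 < Cmod (f z0 - g z0)).
  { apply Cmod_gt_0. intros A. apply N. apply Ceq_minus; auto. }
  set (e := Cmod (f z0 - g z0)) in *.
  destruct (Hf (e / 2)) as (d1 & Hd1 & H1); [lra|].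
  destruct (Hg (e / 2)) as (d2 & Hd2 & H2); [lra|].
  set (d := Rmin r (Rmin d1 d2)).
  assert (Hd : 0 < d) by (repeat apply Rmin_pos; auto).
  set (z := (z0 + RtoC (d / 2))%C).
  assert (Dz : Cmod (z - z0) = d / 2).
  { unfold z. replace (z0 + RtoC (d / 2) - z0)%C with (RtoC (d / 2)) by ring.
    rewrite Cmod_R. apply Rabs_pos_eq. lra. }
  assert (Hz : Cmod (z - z0) < d) by lra. unfold d in Hz.
  apply Rmin_Rgt in Hz as [Hz3 Hz]. apply Rmin_Rgt in Hz as [Hz1 Hz2].
  specialize (H1 z Hz1). specialize (H2 z Hz2).
  rewrite (E z) in H1; auto.
  2:{ intros A. rewrite A in Dz. replace (z0 - z0)%C with (RtoC 0) in Dz by ring.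
      rewrite Cmod_0 in Dz. lra. }
  pose proof (Cmod_triangle (f z0 - g z) (g z - g z0)) as T.
  replace (f z0 - g z + (g z - g z0))%C with (f z0 - g z0)%C in T by ring.
  fold e in T. rewrite Cmod_sub_sym in H1. lra.
Qed.

Lemma is_Cderive_unique (f : C -> C) (z0 d1 d2 : C) :
  is_Cderive f z0 d1 -> is_Cderive f z0 d2 -> d1 = d2.
Proof.
  intros (K & HK & EK & H) (L & HL & EL & H').
  rewrite <- EK, <- EL. apply (Ccontinuous_unique K L z0 1); auto; [lra|].
  intros z N _. assert (A : (z - z0)%C <> RtoC 0).
  { intros A. apply N. apply Ceq_minus; auto. }
  transitivity ((f z - f z0) / (z - z0))%C;
    [rewrite H|rewrite H']; field; auto.
Qed.

Lemma locally_C (z : C) (P : C -> Prop) :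
  locally z P <-> exists d : R, 0 < d /\ forall y, Cmod (y - z) < d -> P y.
Proof.
  split.
  - intros (e & H). exists e. split; [apply cond_pos|]. intros y Hy. apply H.
    apply C_NormedModule_mixin_compat1. exact Hy.
  - intros (d & Hd & H).
    assert (Hd' : 0 < d / sqrt 2) by (apply Rdiv_lt_0_compat; [lra|apply Rlt_sqrt2_0]).
    exists (mkposreal _ Hd'). intros y Hy. apply H.
    pose proof (C_NormedModule_mixin_compat2 z y _ Hy) as B. simpl in B.
    replace (sqrt 2 * (d / sqrt 2)) with d in B.
    + exact B.
    + field. apply Rgt_not_eq, Rlt_sqrt2_0.
Qed.

(** [C_derive] is a limit along the real direction only, so it agrees with any
    derivative in the full complex sense. *)
Lemma is_Cderive_C_derive (f : C -> C) (z0 d : C) : is_Cderive f z0 d -> C_derive f z0 = d.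
Proof.
  intros (K & HK & EK & H). unfold C_derive. apply is_C_lim_unique.
  intros P HP. apply locally_C in HP as (e & He & HP).
  destruct (HK e He) as (dl & Hdl & HK').
  unfold filtermap, locally', within. apply locally_C.
  exists dl. split; auto. intros y Hy N. apply HP.
  rewrite H. replace ((y - z0) * K y / (y - z0))%C with (K y).
  - rewrite <- EK. auto.
  - field. intros A. apply N. apply Ceq_minus; auto.
Qed.

(** * Power series and their sums *)

Fixpoint csum (u : nat -> C) (n : nat) : C :=
  match n with O => RtoC 0 | S m => (csum u m + u m)%C end.

(** The first [n] terms of the series, so that index 0 gives the empty sum. *)
Definition psum (a : nat -> C) (z : C) : nat -> C := csum (fun k => a k * z ^ k)%C.

Lemma pow_n_Cpow (z : C) (k : nat) : pow_n (K := C_AbsRing) z k = (z ^ k)%C.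
Proof. induction k; [reflexivity|]. simpl. rewrite IHk. reflexivity. Qed.

Lemma sum_n_csum (u : nat -> C) (n : nat) :
  sum_n (G := C_AbelianMonoid) u n = csum u (S n).
Proof.
  induction n.
  - rewrite sum_O. simpl. ring.
  - rewrite sum_Sn, IHn. reflexivity.
Qed.

Lemma is_series_csum (u : nat -> C) (l : C) :
  is_cseries u l <->
  forall eps : R, 0 < eps -> exists N : nat, forall n : nat, (N <= n)%nat ->
    Cmod (csum u n - l) < eps.
Proof.
  split.
  - intros H eps He.
    assert (L : locally (l : C) (fun y => Cmod (y - l) < eps)).
    { apply locally_C. exists eps. split; auto. }
    destruct (H _ L) as (N & HN). exists (S N). intros [|n] Hn; [lia|].
    rewrite <- sum_n_csum. apply HN. lia.
  - intros H P HP. apply locally_C in HP as (e & He & HP).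
    destruct (H e He) as (N & HN). exists N. intros n Hn. apply HP.
    rewrite sum_n_csum. apply HN. lia.
Qed.

Lemma is_pseries_is_series (a : nat -> C) (z l : C) :
  is_cpseries a z l <->
  is_cseries (fun k => a k * z ^ k)%C l.
Proof.
  assert (E : forall k, scal (K := C_AbsRing) (V := C_NormedModule)
            (pow_n (K := C_AbsRing) z k) (a k) = (a k * z ^ k)%C).
  { intros k. rewrite pow_n_Cpow. change ((z ^ k * a k)%C = (a k * z ^ k)%C). ring. }
  split; intros H; (eapply is_series_ext; [|exact H]); intros k; simpl; rewrite E; auto.
Qed.

Lemma is_pseries_psum (a : nat -> C) (z l : C) :
  is_cpseries a z l <->
  forall eps : R, 0 < eps -> exists N : nat, forall n : nat, (N <= n)%nat ->
    Cmod (psum a z n - l) < eps.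
Proof. rewrite is_pseries_is_series. apply is_series_csum. Qed.

Lemma is_pseries_uniq (a : nat -> C) (z l1 l2 : C) :
  is_cpseries a z l1 ->
  is_cpseries a z l2 -> l1 = l2.
Proof.
  rewrite !is_pseries_psum. intros H1 H2. apply NNPP. intros N.
  assert (P : 0 < Cmod (l1 - l2)).
  { apply Cmod_gt_0. intros A. apply N. apply Ceq_minus; auto. }
  destruct (H1 (Cmod (l1 - l2) / 2)) as (N1 & Q1); [lra|].
  destruct (H2 (Cmod (l1 - l2) / 2)) as (N2 & Q2); [lra|].
  specialize (Q1 (N1 + N2)%nat ltac:(lia)). specialize (Q2 (N1 + N2)%nat ltac:(lia)).
  set (s := psum a z (N1 + N2)) in *.
  pose proof (Cmod_triangle (l1 - s) (s - l2)) as T.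
  replace (l1 - s + (s - l2))%C with (l1 - l2)%C in T by ring.
  rewrite Cmod_sub_sym in Q1. lra.
Qed.

Lemma is_pseries_center (a : nat -> C) :
  is_cpseries a (RtoC 0) (a 0%nat).
Proof. exact (is_pseries_0 (K := C_AbsRing) (V := C_NormedModule) a). Qed.

Lemma psum_shift (a : nat -> C) (z : C) (n : nat) :
  psum a z (S n) = (a 0%nat + z * psum (fun k => a (S k)) z n)%C.
Proof.
  unfold psum. induction n; [simpl; ring|].
  change (csum (fun k => a k * z ^ k) (S (S n)))%C
    with (csum (fun k => a k * z ^ k) (S n) + a (S n) * z ^ (S n))%C.
  rewrite IHn. simpl. ring.
Qed.

Lemma is_pseries_shift (a : nat -> C) (z l : C) :
  z <> RtoC 0 ->
  is_cpseries a z l ->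
  is_cpseries
    (fun k => a (S k)) z ((l - a 0%nat) / z)%C.
Proof.
  rewrite !is_pseries_psum. intros Hz H eps He.
  assert (Pz : 0 < Cmod z) by (apply Cmod_gt_0; auto).
  destruct (H (eps * Cmod z)) as (N & HN); [apply Rmult_lt_0_compat; auto|].
  exists N. intros n Hn. specialize (HN (S n) ltac:(lia)).
  rewrite psum_shift in HN.
  replace (psum (fun k => a (S k)) z n - (l - a 0%nat) / z)%C
    with ((a 0%nat + z * psum (fun k => a (S k)) z n - l) / z)%C by (field; auto).
  rewrite Cmod_div by auto. apply Rmult_lt_reg_r with (Cmod z); auto.
  unfold Rdiv. rewrite Rmult_assoc, Rinv_l by lra. lra.
Qed.

Lemma is_pseries_shift_n (a : nat -> C) (z l : C) (n : nat) :
  z <> RtoC 0 -> (forall k, (k < n)%nat -> a k = RtoC 0) ->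
  is_cpseries a z l ->
  is_cpseries
    (fun k => a (n + k)%nat) z (l / z ^ n)%C.
Proof.
  intros Hz. revert a l. induction n; intros a l Ha H.
  - replace (l / z ^ 0)%C with l by (simpl; field). exact H.
  - apply (is_pseries_shift a z l Hz) in H. rewrite Ha in H by lia.
    apply IHn in H.
    + replace (l / z ^ (S n))%C with ((l - 0) / z / z ^ n)%C; [exact H|].
      rewrite Cpow_S. field. split; auto. apply Cpow_nz; auto.
    + intros k Hk. apply Ha. lia.
Qed.

(** The terms of a convergent series tend to zero, in particular they are
    bounded; all later majorations of power series start from this. *)
Lemma is_pseries_bounded (a : nat -> C) (z l : C) :
  is_cpseries a z l ->
  exists M : R, 0 < M /\ forall k, Cmod (a k) * Cmod z ^ k <= M.
Proof.
  rewrite is_pseries_psum. intros H.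
  destruct (H 1) as (N & HN); [lra|].
  assert (B : exists M, 0 < M /\ forall k, (k < N)%nat -> Cmod (a k) * Cmod z ^ k <= M).
  { clear. induction N as [|N (M & HM & IH)].
    - exists 1. split; [lra|]. intros; lia.
    - exists (Rmax M (Cmod (a N) * Cmod z ^ N)). split.
      + eapply Rlt_le_trans; [exact HM|apply Rmax_l].
      + intros k Hk. destruct (Nat.eq_dec k N) as [->|Hne]; [apply Rmax_r|].
        eapply Rle_trans; [apply IH; lia|apply Rmax_l]. }
  destruct B as (M & HM & B). exists (M + 2). split; [lra|].
  intros k. destruct (Compare_dec.le_lt_dec N k) as [Hk|Hk]; [|specialize (B k Hk); lra].
  pose proof (HN k ltac:(lia)) as H1. pose proof (HN (S k) ltac:(lia)) as H2.
  rewrite <- Cmod_pow, <- Cmod_mult.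
  replace (a k * z ^ k)%C with ((psum a z (S k) - l) + - (psum a z k - l))%C
    by (unfold psum; simpl; ring).
  eapply Rle_trans; [apply Cmod_triangle|]. rewrite Cmod_opp. lra.
Qed.

(** The factor (r/2)^k instead of k (r/4)^(k-1) absorbs the factor k, so that
    geometric majorants suffice below. *)
Lemma Cpow_sub_le (z w : C) (r : R) (k : nat) :
  0 < r -> Cmod z <= r / 4 -> Cmod w <= r / 4 ->
  Cmod (z ^ k - w ^ k) <= 4 / r * (r / 2) ^ k * Cmod (z - w).
Proof.
  intros Hr Hz Hw. induction k.
  - simpl. replace (1 - 1)%C with (RtoC 0) by ring. rewrite Cmod_0, Rmult_1_r.
    apply Rmult_le_pos; [|apply Cmod_ge_0]. apply Rlt_le, Rdiv_lt_0_compat; lra.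
  - rewrite !Cpow_S.
    replace (z * z ^ k - w * w ^ k)%C with (z * (z ^ k - w ^ k) + (z - w) * w ^ k)%C by ring.
    eapply Rle_trans; [apply Cmod_triangle|]. rewrite !Cmod_mult, Cmod_pow.
    assert (A : Cmod z * Cmod (z ^ k - w ^ k) <=
              r / 4 * (4 / r * (r / 2) ^ k * Cmod (z - w))).
    { apply Rmult_le_compat; auto; apply Cmod_ge_0. }
    assert (B : Cmod (z - w) * Cmod w ^ k <= Cmod (z - w) * (r / 2) ^ k).
    { apply Rmult_le_compat_l; [apply Cmod_ge_0|]. apply pow_incr. split; [apply Cmod_ge_0|lra]. }
    replace (4 / r * (r / 2) ^ S k * Cmod (z - w))
      with (r / 4 * (4 / r * (r / 2) ^ k * Cmod (z - w)) + Cmod (z - w) * (r / 2) ^ k)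
      by (simpl; field; lra).
    lra.
Qed.

Lemma psum_lipschitz (a : nat -> C) (z w : C) (r M : R) (n : nat) :
  0 < r -> (forall k, Cmod (a k) * r ^ k <= M) ->
  Cmod z <= r / 4 -> Cmod w <= r / 4 ->
  Cmod (psum a z n - psum a w n) <= 8 * M / r * (1 - (1 / 2) ^ n) * Cmod (z - w).
Proof.
  intros Hr HM Hz Hw. unfold psum. induction n.
  - simpl. replace (0 - 0)%C with (RtoC 0) by ring. rewrite Cmod_0. right. ring.
  - simpl csum.
    match goal with |- Cmod ?x <= _ => replace x with
      ((csum (fun k => a k * z ^ k) n - csum (fun k => a k * w ^ k) n) + a n * (z ^ n - w ^ n))%C
      by ring end.
    eapply Rle_trans; [apply Cmod_triangle|]. rewrite Cmod_mult.
    assert (A : Cmod (a n) * Cmod (z ^ n - w ^ n) <= 4 * M / r * (1 / 2) ^ n * Cmod (z - w)).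
    { eapply Rle_trans.
      - apply Rmult_le_compat_l; [apply Cmod_ge_0|]. apply (Cpow_sub_le z w r n); auto.
      - replace (Cmod (a n) * (4 / r * (r / 2) ^ n * Cmod (z - w)))
          with (Cmod (a n) * r ^ n * (4 / r * (1 / 2) ^ n * Cmod (z - w))).
        + replace (4 * M / r * (1 / 2) ^ n * Cmod (z - w))
            with (M * (4 / r * (1 / 2) ^ n * Cmod (z - w))) by (field; lra).
          apply Rmult_le_compat_r; auto.
          repeat apply Rmult_le_pos; try apply Cmod_ge_0; try lra.
          * apply Rlt_le, Rinv_0_lt_compat; auto.
          * apply pow_le; lra.
        + replace (r / 2) with (r * (1 / 2)) by field. rewrite Rpow_mult_distr. ring. }
    replace (8 * M / r * (1 - (1 / 2) ^ S n) * Cmod (z - w))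
      with (8 * M / r * (1 - (1 / 2) ^ n) * Cmod (z - w) + 4 * M / r * (1 / 2) ^ n * Cmod (z - w))
      by (simpl; field; lra).
    lra.
Qed.

(** This is what a power series gives near its centre without differentiating it
    term by term: it yields continuity and a local bound on the derivative. *)
Definition locally_lipschitz (f : C -> C) (z0 : C) : Prop :=
  exists delta L : R, 0 < delta /\ 0 < L /\
  forall z w : C, Cmod (z - z0) < delta -> Cmod (w - z0) < delta ->
    Cmod (f z - f w) <= L * Cmod (z - w).

(** The partial sums are Lipschitz with a common constant, which passes to the
    limit. *)
Lemma pseries_lipschitz (f : C -> C) (a : nat -> C) (z0 : C) (eps : R) :
  0 < eps ->
  (forall z, Cmod (z - z0) < eps ->
     is_cpseries a (z - z0)%C (f z)) ->
  locally_lipschitz f z0.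
Proof.
  intros He H.
  set (r := eps / 2).
  assert (B : exists M, 0 < M /\ forall k, Cmod (a k) * r ^ k <= M).
  { assert (Hz : Cmod (z0 + r - z0) = r).
    { replace (z0 + r - z0)%C with (RtoC r) by ring.
      rewrite Cmod_R. apply Rabs_pos_eq. unfold r; lra. }
    specialize (H (z0 + r)%C ltac:(rewrite Hz; unfold r; lra)).
    apply is_pseries_bounded in H. rewrite Hz in H. exact H. }
  destruct B as (M & HM & B). assert (Hr : 0 < r) by (unfold r; lra).
  assert (HL : 0 < 8 * M / r) by (apply Rdiv_lt_0_compat; lra).
  exists (r / 4), (8 * M / r). split; [lra|]. split; auto.
  intros z w Hz Hw.
  pose proof (H z ltac:(unfold r in *; lra)) as Sz.
  pose proof (H w ltac:(unfold r in *; lra)) as Sw.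
  rewrite is_pseries_psum in Sz, Sw.
  apply le_epsilon. intros e Hee.
  destruct (Sz (e / 2)) as (N1 & Q1); [lra|].
  destruct (Sw (e / 2)) as (N2 & Q2); [lra|].
  specialize (Q1 (N1 + N2)%nat ltac:(lia)). specialize (Q2 (N1 + N2)%nat ltac:(lia)).
  pose proof (psum_lipschitz a (z - z0) (w - z0) r M (N1 + N2) Hr B
    (Rlt_le _ _ Hz) (Rlt_le _ _ Hw)) as Q.
  set (s := psum a (z - z0) (N1 + N2)) in *. set (t := psum a (w - z0) (N1 + N2)) in *.
  replace (z - z0 - (w - z0))%C with (z - w)%C in Q by ring.
  replace (f z - f w)%C with (- (s - f z) + (s - t) + (t - f w))%C by ring.
  eapply Rle_trans; [apply Cmod_triangle|].
  eapply Rle_trans; [apply Rplus_le_compat_r, Cmod_triangle|]. rewrite Cmod_opp.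
  assert (8 * M / r * (1 - (1 / 2) ^ (N1 + N2)) * Cmod (z - w) <= 8 * M / r * Cmod (z - w)).
  { apply Rmult_le_compat_r; [apply Cmod_ge_0|].
    rewrite <- (Rmult_1_r (8 * M / r)) at 2. apply Rmult_le_compat_l; [lra|].
    assert (0 <= (1 / 2) ^ (N1 + N2)) by (apply pow_le; lra). lra. }
  lra.
Qed.

Lemma locally_lipschitz_Ccontinuous (f : C -> C) (z0 : C) : locally_lipschitz f z0 -> Ccontinuous f z0.
Proof.
  intros (d & L & Hd & HL & H) e He. exists (Rmin d (e / L)).
  split; [apply Rmin_pos; auto; apply Rdiv_lt_0_compat; auto|].
  intros z Hz. apply Rmin_Rgt in Hz as [H1 H2].
  eapply Rle_lt_trans; [apply H; auto|].
  - replace (z0 - z0)%C with (RtoC 0) by ring. rewrite Cmod_0. lra.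
  - apply Rlt_le_trans with (L * (e / L)); [apply Rmult_lt_compat_l; auto|].
    right. field. lra.
Qed.

Lemma analytic_lipschitz (U : C -> Prop) (f : C -> C) (z0 : C) :
  analytic_on U f -> U z0 -> locally_lipschitz f z0.
Proof.
  intros H Hz. destruct (H z0 Hz) as (a & eps & Ha).
  apply (pseries_lipschitz f a z0 eps); auto. apply cond_pos.
Qed.

Lemma analytic_Ccontinuous (U : C -> Prop) (f : C -> C) (z0 : C) :
  analytic_on U f -> U z0 -> Ccontinuous f z0.
Proof. intros. apply locally_lipschitz_Ccontinuous, (analytic_lipschitz U); auto. Qed.

(** * Algebra of analytic functions; division by linear factors *)

Lemma analytic_const (U : C -> Prop) (c : C) : analytic_on U (fun _ => c).
Proof.
  intros z0 _. exists (fun k => match k with O => c | _ => RtoC 0 end), (mkposreal 1 Rlt_0_1).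
  intros z _. apply is_pseries_psum. intros e He. exists 1%nat.
  assert (E : forall n, psum (fun k => match k with O => c | _ => RtoC 0 end) (z - z0) (S n) = c).
  { intros n. unfold psum. induction n; [simpl; ring|].
    change (csum (fun k => match k with O => c | _ => RtoC 0 end * (z - z0) ^ k) (S n)
       + 0 * (z - z0) ^ S n = c)%C. rewrite IHn. ring. }
  intros [|n] Hn; [lia|]. rewrite E. replace (c - c)%C with (RtoC 0) by ring.
  rewrite Cmod_0. lra.
Qed.

Lemma analytic_plus (U : C -> Prop) (f g : C -> C) :
  analytic_on U f -> analytic_on U g -> analytic_on U (fun z => f z + g z)%C.
Proof.
  intros Hf Hg z0 Hz. destruct (Hf z0 Hz) as (a & e1 & Ha). destruct (Hg z0 Hz) as (b & e2 & Hb).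
  exists (PS_plus a b).
  exists (mkposreal _ (Rmin_pos _ _ (cond_pos e1) (cond_pos e2))). intros z Hzz. simpl in Hzz.
  apply Rmin_Rgt in Hzz as [H1 H2].
  exact (is_pseries_plus (K := C_AbsRing) (V := C_NormedModule) a b _ _ _ (Ha z H1) (Hb z H2)).
Qed.

Lemma analytic_scal (U : C -> Prop) (c : C) (f : C -> C) :
  analytic_on U f -> analytic_on U (fun z => c * f z)%C.
Proof.
  intros Hf z0 Hz. destruct (Hf z0 Hz) as (a & e1 & Ha). exists (PS_scal c a), e1.
  intros z H1.
  apply (is_pseries_scal (K := C_AbsRing) (V := C_NormedModule) c a _ _); [|apply Ha; auto].
  change ((z - z0) * c = c * (z - z0))%C. ring.
Qed.

Lemma analytic_ext (U : C -> Prop) (f g : C -> C) :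
  (forall z, f z = g z) -> analytic_on U f -> analytic_on U g.
Proof.
  intros E Hf z0 Hz. destruct (Hf z0 Hz) as (a & e1 & Ha). exists a, e1.
  intros z H1. rewrite <- E. auto.
Qed.

Lemma analytic_mult_id (U : C -> Prop) (f : C -> C) :
  analytic_on U f -> analytic_on U (fun z => z * f z)%C.
Proof.
  intros Hf z0 Hz.
  destruct (analytic_scal U z0 f Hf z0 Hz) as (b & e2 & Hb).
  destruct (Hf z0 Hz) as (a & e1 & Ha).
  exists (PS_plus (PS_incr_1 a) b).
  exists (mkposreal _ (Rmin_pos _ _ (cond_pos e1) (cond_pos e2))). intros z Hzz. simpl in Hzz.
  apply Rmin_Rgt in Hzz as [H1 H2].
  replace (z * f z)%C with ((z - z0) * f z + z0 * f z)%C by ring.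
  apply (is_pseries_plus (K := C_AbsRing) (V := C_NormedModule)); [|auto].
  apply (is_pseries_incr_1 (K := C_AbsRing) (V := C_NormedModule)). auto.
Qed.

Lemma analytic_id (U : C -> Prop) : analytic_on U (fun z => z).
Proof.
  apply analytic_ext with (fun z => z * 1)%C; [intros; ring|].
  apply analytic_mult_id, analytic_const.
Qed.

Lemma analytic_pow (U : C -> Prop) (n : nat) : analytic_on U (fun z => z ^ n)%C.
Proof. induction n; [exact (analytic_const U 1)|]. exact (analytic_mult_id U (fun z => z ^ n)%C IHn). Qed.

(** Coefficients of the quotient of the series by h - c, by synthetic division
    for c different from 0. *)
Fixpoint div_coef (a : nat -> C) (c : C) (n : nat) : C :=
  match n with
  | O => (- (a 0%nat / c))%C
  | S m => ((div_coef a c m - a (S m)) / c)%C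
  end.

(** Synthetic division of the truncated series; the last summand is its
    remainder. *)
Lemma psum_div_coef (a : nat -> C) (c h : C) (n : nat) :
  c <> RtoC 0 ->
  ((h - c) * psum (div_coef a c) h (S n) = psum a h (S n) + div_coef a c n * h ^ (S n))%C.
Proof.
  intros Hc. unfold psum. induction n; [simpl; field; auto|].
  change (csum (fun k => div_coef a c k * h ^ k) (S (S n)))%C
    with (csum (fun k => div_coef a c k * h ^ k) (S n) + div_coef a c (S n) * h ^ (S n))%C.
  change (csum (fun k => a k * h ^ k) (S (S n)))%C
    with (csum (fun k => a k * h ^ k) (S n) + a (S n) * h ^ (S n))%C.
  rewrite Cmult_plus_distr_l, IHn. simpl. field. auto.
Qed.

Lemma is_pseries_terms (a : nat -> C) (z l : C) :
  is_cpseries a z l ->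
  forall e, 0 < e -> exists N, forall k, (N <= k)%nat -> Cmod (a k * z ^ k) < e.
Proof.
  rewrite is_pseries_psum. intros H e He.
  destruct (H (e / 2)) as (N & HN); [lra|]. exists N. intros k Hk.
  pose proof (HN k ltac:(lia)) as H1. pose proof (HN (S k) ltac:(lia)) as H2.
  replace (a k * z ^ k)%C with ((psum a z (S k) - l) + - (psum a z k - l))%C
    by (unfold psum; simpl; ring).
  eapply Rle_lt_trans; [apply Cmod_triangle|]. rewrite Cmod_opp. lra.
Qed.

(** The terms u_k of the quotient series satisfy u_(k+1) = (h/c) u_k + o(1) with
    |h/c| <= 1/2, hence they tend to zero. *)
Lemma div_coef_terms (a : nat -> C) (c h l : C) :
  c <> RtoC 0 -> Cmod h <= Cmod c / 2 ->
  is_cpseries a h l ->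
  forall e, 0 < e -> exists N, forall k, (N <= k)%nat -> Cmod (div_coef a c k * h ^ k) < e.
Proof.
  intros Hc Hh H e He.
  assert (Pc : 0 < Cmod c) by (apply Cmod_gt_0; auto).
  set (u := fun k => Cmod (div_coef a c k * h ^ k)).
  destruct (is_pseries_terms a h l H (e / 4 * Cmod c)) as (N & HN).
  { apply Rmult_lt_0_compat; lra. }
  assert (Rec : forall k, (N <= k)%nat -> u (S k) <= u k / 2 + e / 4).
  { intros k Hk. unfold u. simpl div_coef.
    replace ((div_coef a c k - a (S k)) / c * h ^ S k)%C
      with (h / c * (div_coef a c k * h ^ k) + - (a (S k) * h ^ S k / c))%C
      by (simpl; field; auto).
    eapply Rle_trans; [apply Cmod_triangle|]. rewrite Cmod_opp, Cmod_mult, !Cmod_div by auto.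
    apply Rplus_le_compat.
    - rewrite Rmult_comm. apply Rmult_le_compat_l; [apply Cmod_ge_0|].
      apply Rmult_le_reg_r with (Cmod c); auto. unfold Rdiv. rewrite Rmult_assoc, Rinv_l; lra.
    - specialize (HN (S k) ltac:(lia)). apply Rmult_le_reg_r with (Cmod c); auto.
      unfold Rdiv at 1. rewrite Rmult_assoc, Rinv_l; lra. }
  assert (Exp : forall j, u (N + j)%nat <= u N * (1 / 2) ^ j + e / 2).
  { induction j.
    - rewrite Nat.add_0_r. simpl. lra.
    - rewrite Nat.add_succ_r. eapply Rle_trans; [apply Rec; lia|]. simpl. lra. }
  destruct (pow_lt_1_zero (1 / 2) ltac:(rewrite Rabs_pos_eq; lra) (e / 2 / (u N + 1))) as (J & HJ).
  { assert (0 <= u N) by apply Cmod_ge_0. repeat apply Rdiv_lt_0_compat; lra. }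
  exists (N + J)%nat. intros k Hk. replace k with (N + (k - N))%nat by lia.
  change (u (N + (k - N))%nat < e).
  eapply Rle_lt_trans; [apply Exp|].
  specialize (HJ (k - N)%nat ltac:(lia)). rewrite Rabs_pos_eq in HJ by (apply pow_le; lra).
  assert (Pu : 0 <= u N) by apply Cmod_ge_0.
  assert (u N * (1 / 2) ^ (k - N) <= u N * (e / 2 / (u N + 1))) by (apply Rmult_le_compat_l; lra).
  assert (u N * (e / 2 / (u N + 1)) < e / 2).
  { replace (u N * (e / 2 / (u N + 1))) with (e / 2 * (u N / (u N + 1))) by (field; lra).
    rewrite <- (Rmult_1_r (e / 2)) at 2. apply Rmult_lt_compat_l; [lra|].
    apply Rmult_lt_reg_r with (u N + 1); [lra|]. unfold Rdiv. rewrite Rmult_assoc, Rinv_l; lra. }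
  lra.
Qed.

Lemma is_pseries_div (a : nat -> C) (c h l : C) :
  c <> RtoC 0 -> Cmod h <= Cmod c / 2 ->
  is_cpseries a h l ->
  is_cpseries (div_coef a c) h (l / (h - c))%C.
Proof.
  intros Hc Hh H. pose proof (div_coef_terms a c h l Hc Hh H) as T.
  rewrite is_pseries_psum in *. intros e He.
  assert (Pc : 0 < Cmod c) by (apply Cmod_gt_0; auto).
  assert (Phc : Cmod c / 2 <= Cmod (h - c)).
  { pose proof (Cmod_triangle_sub c h) as Q. rewrite Cmod_sub_sym in Q. lra. }
  assert (Nhc : (h - c)%C <> RtoC 0) by (apply Cmod_gt_0; lra).
  set (D := Cmod (h - c)) in *. assert (PD : 0 < D) by lra.
  destruct (H (e / 2 * D)) as (N1 & HN1); [apply Rmult_lt_0_compat; lra|].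
  destruct (T (e / 2)) as (N2 & HN2); [lra|].
  exists (S (N1 + N2)). intros [|n] Hn; [lia|].
  specialize (HN1 (S n) ltac:(lia)). specialize (HN2 n ltac:(lia)).
  replace (psum (div_coef a c) h (S n) - l / (h - c))%C
    with (((h - c) * psum (div_coef a c) h (S n) - l) / (h - c))%C by (field; auto).
  rewrite psum_div_coef by auto. rewrite Cmod_div by auto. fold D.
  apply Rmult_lt_reg_r with D; auto. unfold Rdiv. rewrite Rmult_assoc, Rinv_l, Rmult_1_r by lra.
  replace (psum a h (S n) + div_coef a c n * h ^ S n - l)%C
    with ((psum a h (S n) - l) + h * (div_coef a c n * h ^ n))%C by (simpl; ring).
  eapply Rle_lt_trans; [apply Cmod_triangle|]. rewrite Cmod_mult.
  assert (Cmod h * Cmod (div_coef a c n * h ^ n) <= D * (e / 2)).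
  { apply Rmult_le_compat; try apply Cmod_ge_0; lra. }
  lra.
Qed.

(** At [z0] the quotient is the shifted series; at any other point the series of
    [f] is divided by a linear factor that does not vanish there. *)
Lemma analytic_divide (U : C -> Prop) (f : C -> C) (z0 : C) :
  analytic_on U f -> U z0 -> f z0 = RtoC 0 ->
  exists g : C -> C, analytic_on U g /\ forall z : C, f z = ((z - z0) * g z)%C.
Proof.
  intros Hf Hz0 E.
  destruct (Hf z0 Hz0) as (a & eps & Ha).
  assert (A0 : a 0%nat = RtoC 0).
  { specialize (Ha z0). replace (z0 - z0)%C with (RtoC 0) in Ha by ring.
    rewrite Cmod_0, E in Ha. specialize (Ha (cond_pos eps)).
    apply (is_pseries_uniq a (RtoC 0)); auto. apply is_pseries_center. }
  exists (fun z => if Ceq_dec z z0 then a 1%nat else (f z / (z - z0))%C).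
  split.
  2:{ intros z. destruct (Ceq_dec z z0) as [->|N]; [rewrite E; ring|].
      field. intros A. apply N. apply Ceq_minus; auto. }
  intros z1 Hz1. destruct (Ceq_dec z1 z0) as [->|N1].
  - exists (fun k => a (S k)), eps. intros z Hz.
    destruct (Ceq_dec z z0) as [->|N].
    + replace (z0 - z0)%C with (RtoC 0) by ring. apply (is_pseries_center (fun k => a (S k))).
    + replace (f z)%C with (f z - a 0%nat)%C by (rewrite A0; ring).
      apply is_pseries_shift; auto. intros A. apply N. apply Ceq_minus; auto.
  - assert (Nc : (z0 - z1)%C <> RtoC 0).
    { intros A. apply N1. symmetry. apply Ceq_minus; auto. }
    assert (Pc : 0 < Cmod (z0 - z1)) by (apply Cmod_gt_0; auto).
    destruct (Hf z1 Hz1) as (b & e1 & Hb).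
    assert (Pe : 0 < Rmin e1 (Cmod (z0 - z1) / 2)) by (apply Rmin_pos; [apply cond_pos|lra]).
    exists (div_coef b (z0 - z1)), (mkposreal _ Pe). intros z Hz. simpl in Hz.
    apply Rmin_Rgt in Hz as [H1 H2].
    destruct (Ceq_dec z z0) as [->|N]; [lra|].
    replace (f z / (z - z0))%C with (f z / ((z - z1) - (z0 - z1)))%C by (f_equal; ring).
    apply is_pseries_div; auto. lra.
Qed.

(** Divide [f - f z0] by [z - z0]: the quotient is analytic, hence continuous. *)
Lemma analytic_is_Cderive (U : C -> Prop) (f : C -> C) (z0 : C) :
  analytic_on U f -> U z0 -> exists d : C, is_Cderive f z0 d.
Proof.
  intros Hf Hz0.
  destruct (analytic_divide U (fun z => f z + - f z0)%C z0) as (g & Hg & E); auto.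
  - apply analytic_plus; auto. apply analytic_const.
  - ring.
  - exists (g z0), g. split; [apply (analytic_Ccontinuous U); auto|]. split; auto.
Qed.

(** A zero of order [n] is removed one factor at a time.  The order is given as a
    growth bound because this is how zeros of quotients such as z g'/g - 1 are
    found. *)
Lemma analytic_divide_pow (U : C -> Prop) (f : C -> C) (n : nat) (K delta : R) :
  U (RtoC 0) -> analytic_on U f -> 0 < delta ->
  (forall z, z <> RtoC 0 -> Cmod z < delta -> Cmod (f z) <= K * Cmod z ^ n) ->
  exists g : C -> C, analytic_on U g /\ forall z : C, f z = (z ^ n * g z)%C.
Proof.
  intros U0 Hf Hd. revert f Hf. induction n; intros f Hf HK.
  - exists f. split; auto. intros z. simpl. ring.
  - assert (F0 : f (RtoC 0) = RtoC 0).
    { apply NNPP. intros N. assert (P : 0 < Cmod (f 0)) by (apply Cmod_gt_0; auto).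
      destruct (analytic_Ccontinuous U f (RtoC 0) Hf U0 (Cmod (f 0) / 2)) as (d1 & Hd1 & H1); [lra|].
      assert (K0 : 0 < Rabs K + 1) by (pose proof (Rabs_pos K); lra).
      set (s := Rmin (Rmin d1 delta) (Rmin 1 (Cmod (f 0) / 2 / (Rabs K + 1))) / 2).
      assert (Hs : 0 < s).
      { apply Rdiv_lt_0_compat; [|lra].
        repeat apply Rmin_pos; try lra. repeat apply Rdiv_lt_0_compat; lra. }
      assert (Hs2 : s < Rmin (Rmin d1 delta) (Rmin 1 (Cmod (f 0) / 2 / (Rabs K + 1)))).
      { unfold s in *. lra. }
      clearbody s.
      apply Rmin_Rgt in Hs2 as [Hs2 Hs3]. apply Rmin_Rgt in Hs2 as [S1 S2].
      apply Rmin_Rgt in Hs3 as [S3 S4].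
      assert (Ms : Cmod (RtoC s) = s) by (rewrite Cmod_R; apply Rabs_pos_eq; lra).
      specialize (H1 (RtoC s)). replace (s - 0)%C with (RtoC s) in H1 by ring.
      rewrite Ms in H1. specialize (H1 S1).
      assert (Ns : RtoC s <> RtoC 0) by (apply Cmod_gt_0; lra).
      specialize (HK (RtoC s) Ns). rewrite Ms in HK. specialize (HK S2).
      assert (K * s ^ S n <= (Rabs K + 1) * s).
      { simpl. apply Rle_trans with (Rabs K * (s * s ^ n)).
        - apply Rmult_le_compat_r; [|apply Rle_abs]. apply Rmult_le_pos; [lra|apply pow_le; lra].
        - apply Rmult_le_compat; try lra.
          + apply Rabs_pos.
          + apply Rmult_le_pos; [lra|apply pow_le; lra].
          + apply Rle_trans with (s * 1); [|lra]. apply Rmult_le_compat_l; [lra|].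
            rewrite <- (pow1 n). apply pow_incr. lra. }
      assert ((Rabs K + 1) * s < Cmod (f 0) / 2).
      { apply Rlt_le_trans with ((Rabs K + 1) * (Cmod (f 0) / 2 / (Rabs K + 1))).
        - apply Rmult_lt_compat_l; auto.
        - right. field. lra. }
      pose proof (Cmod_triangle_sub (f 0) (f s)) as T. rewrite Cmod_sub_sym in T. lra. }
    destruct (analytic_divide U f (RtoC 0) Hf U0 F0) as (g & Hg & E).
    destruct (IHn g Hg) as (g' & Hg' & E').
    + intros z Nz Hz. specialize (HK z Nz Hz).
      assert (Pz : 0 < Cmod z) by (apply Cmod_gt_0; auto).
      rewrite E, Cmod_mult in HK. replace (z - 0)%C with z in HK by ring.
      apply Rmult_le_reg_l with (Cmod z); auto. simpl in HK. lra.
    + exists g'. split; auto. intros z. rewrite E, E'. simpl. ring.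
Qed.

Lemma Cmod_sub_self (z : C) : Cmod (z - z) = 0.
Proof. replace (z - z)%C with (RtoC 0) by ring. apply Cmod_0. Qed.

(** * Maximum principle for quotients *)

(** The first nonzero coefficient of the local series, if there is one,
    determines the behaviour. *)
Lemma analytic_leading_term (U : C -> Prop) (F : C -> C) (z0 : C) :
  analytic_on U F -> U z0 ->
  exists delta : R, 0 < delta /\
  ((forall z, Cmod (z - z0) < delta -> F z = RtoC 0) \/
   (exists (m : nat) (H : C -> C), Ccontinuous H z0 /\ H z0 <> RtoC 0 /\
      forall z, Cmod (z - z0) < delta -> F z = ((z - z0) ^ m * H z)%C)).
Proof.
  intros HF Hz0. destruct (HF z0 Hz0) as (a & eps & Ha).
  exists eps. split; [apply cond_pos|].
  destruct (classic (forall k, a k = RtoC 0)) as [A0|A1].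
  - left. intros z Hz. apply (is_pseries_uniq a (z - z0) _ _ (Ha z Hz)).
    apply is_pseries_psum. intros e He. exists 0%nat. intros n _.
    assert (E : psum a (z - z0) n = RtoC 0).
    { unfold psum. induction n; [reflexivity|]. simpl. rewrite IHn, A0. ring. }
    rewrite E, Cmod_sub_self. lra.
  - right. apply not_all_ex_not in A1 as (k0 & Hk0).
    assert (L : exists m, a m <> RtoC 0 /\ forall k, (k < m)%nat -> a k = RtoC 0).
    { clear -Hk0. induction k0 as [k0 IH] using (well_founded_induction Wf_nat.lt_wf).
      destruct (classic (exists j, (j < k0)%nat /\ a j <> RtoC 0)) as [(j & Hj & Nj)|N].
      - apply (IH j Hj Nj).
      - exists k0. split; auto. intros k Hk. apply NNPP. intros A. apply N. eauto. }
    destruct L as (m & Hm & Hlt).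
    exists m, (fun z => if Ceq_dec z z0 then a m else (F z / (z - z0) ^ m)%C).
    split; [|split].
    + apply locally_lipschitz_Ccontinuous.
      apply pseries_lipschitz with (fun k => a (m + k)%nat) eps; [apply cond_pos|].
      intros z Hz. destruct (Ceq_dec z z0) as [->|N].
      * replace (z0 - z0)%C with (RtoC 0) by ring.
        replace (a m) with (a (m + 0)%nat) by (f_equal; lia).
        apply (is_pseries_center (fun k => a (m + k)%nat)).
      * apply is_pseries_shift_n; auto. intros A. apply N, Ceq_minus; auto.
    + destruct (Ceq_dec z0 z0); congruence.
    + intros z Hz. destruct (Ceq_dec z z0) as [->|N].
      * pose proof (Ha z0) as H0. rewrite Cmod_sub_self in H0. specialize (H0 (cond_pos eps)).
        replace (z0 - z0)%C with (RtoC 0) in * by ring.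
        rewrite <- (is_pseries_uniq a _ _ _ (is_pseries_center a) H0).
        destruct m; [simpl; ring|]. rewrite (Hlt 0%nat) by lia. simpl. ring.
      * field. apply Cpow_nz. intros A. apply N, Ceq_minus; auto.
Qed.

Lemma de_moivre (t : R) (m : nat) :
  (((cos t, sin t) : C) ^ m)%C = (cos (INR m * t), sin (INR m * t)).
Proof.
  induction m.
  - simpl. rewrite Rmult_0_l, cos_0, sin_0. reflexivity.
  - rewrite Cpow_S, IHm, S_INR. rewrite Rmult_plus_distr_r, Rmult_1_l, cos_plus, sin_plus.
    unfold Cmult. simpl. f_equal; ring.
Qed.

Lemma unimodular_polar (w : C) : Cmod w = 1 -> exists t, w = (cos t, sin t).
Proof.
  intros H. assert (Q : fst w ^ 2 + snd w ^ 2 = 1).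
  { pose proof (Cmod2_alt w) as E. rewrite H in E. unfold Re, Im in E. lra. }
  assert (B : -1 <= fst w <= 1).
  { split; apply Rnot_lt_le; intros A; nra. }
  assert (S : sqrt (1 - (fst w)²) = Rabs (snd w)).
  { rewrite <- sqrt_Rsqr_abs. f_equal. unfold Rsqr. lra. }
  destruct w as [x y]. simpl in *. destruct (Rle_dec 0 y) as [Hy|Hy].
  - exists (acos x). rewrite cos_acos, sin_acos, S, Rabs_pos_eq by lra. reflexivity.
  - exists (- acos x). rewrite cos_neg, sin_neg, cos_acos, sin_acos, S, Rabs_left by lra.
    f_equal. ring.
Qed.

(** Needed to point c h^m in a prescribed direction by the choice of h. *)
Lemma unimodular_root (w : C) (m : nat) :
  Cmod w = 1 -> (0 < m)%nat -> exists u : C, Cmod u = 1 /\ (u ^ m)%C = w.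
Proof.
  intros H Hm. destruct (unimodular_polar w H) as (t & ->).
  exists (cos (t / INR m), sin (t / INR m)). split.
  - unfold Cmod, fst, snd. rewrite <- sqrt_1. f_equal.
    rewrite <- (sin2_cos2 (t / INR m)). unfold Rsqr. ring.
  - rewrite de_moivre. replace (INR m * (t / INR m)) with t; [reflexivity|].
    field. apply not_0_INR. lia.
Qed.

(** The function [M z0 * N - N z0 * M] vanishes at [z0].  If it is not locally
    zero it behaves like c h^m, and choosing the direction of h so that
    c h^m/(N z0 * M z0) is positive increases |N/M| beyond its value at [z0]. *)
Lemma quotient_local_maximum (U : C -> Prop) (N M : C -> C) (z0 : C) :
  analytic_on U N -> analytic_on U M -> U z0 ->
  M z0 <> RtoC 0 -> N z0 <> RtoC 0 ->
  (exists delta, 0 < delta /\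
     forall z, Cmod (z - z0) < delta -> (M z0 * N z = N z0 * M z)%C) \/
  (forall delta, 0 < delta -> exists z, Cmod (z - z0) < delta /\
     Cmod (N z0) * Cmod (M z) < Cmod (M z0) * Cmod (N z)).
Proof.
  intros HN HM Hz0 M0 N0.
  pose (F := fun z => (M z0 * N z + - N z0 * M z)%C).
  assert (HF : analytic_on U F) by (apply analytic_plus; apply analytic_scal; auto).
  destruct (analytic_leading_term U F z0 HF Hz0) as (d & Hd & [Z|(m & H & CH & H0 & E)]).
  { left. exists d. split; auto. intros z Hz. specialize (Z z Hz). unfold F in Z.
    apply Ceq_minus. rewrite <- Z. ring. }
  right. intros delta Hdelta.
  assert (Hm : (0 < m)%nat).
  { destruct m; [|lia]. exfalso. apply H0. specialize (E z0). rewrite Cmod_sub_self in E.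
    specialize (E Hd). simpl in E. rewrite Cmult_1_l in E. rewrite <- E. unfold F. ring. }
  pose (V := fun z => (H z * / (N z0 * M z))%C).
  assert (CM : Ccontinuous M z0) by (apply (analytic_Ccontinuous U); auto).
  assert (CV : Ccontinuous V z0).
  { apply Ccontinuous_mult; auto. apply Ccontinuous_inv.
    - apply Ccontinuous_mult; auto. apply Ccontinuous_const.
    - apply Cmult_neq_0; auto. }
  assert (V0 : V z0 <> RtoC 0).
  { unfold V. apply Cmult_neq_0; auto. intros A.
    apply (Cmult_neq_0 _ _ N0 M0). rewrite <- (Cmult_1_r (N z0 * M z0)%C).
    rewrite <- (Cinv_l (N z0 * M z0)%C); [rewrite A; ring|apply Cmult_neq_0; auto]. }
  assert (PV : 0 < Cmod (V z0)) by (apply Cmod_gt_0; auto).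
  set (v := Cmod (V z0)) in *.
  assert (Nv : RtoC v <> RtoC 0) by (apply Cmod_gt_0; rewrite Cmod_R, Rabs_pos_eq; lra).
  (* The direction u is chosen such that u^m V(z0) is positive. *)
  destruct (unimodular_root (Cconj (V z0) / v)%C m) as (u & Hu & Eu); auto.
  { rewrite Cmod_div, Cmod_conj, Cmod_R, Rabs_pos_eq by (auto; lra). fold v. field. lra. }
  assert (EuV : (u ^ m * V z0)%C = RtoC v).
  { rewrite Eu. replace (Cconj (V z0) / v * V z0)%C with ((V z0 * Cconj (V z0)) / v)%C
      by (field; auto).
    rewrite <- Cmod2_conj. fold v. replace (v ^ 2) with (v * v) by ring.
    rewrite RtoC_mult. field. auto. }
  destruct (CV (v / 2)) as (d1 & Hd1 & CV'); [lra|].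
  destruct (Ccontinuous_neq0 M z0 CM M0) as (d2 & Hd2 & NM).
  set (s := Rmin (Rmin d delta) (Rmin d1 d2) / 2).
  assert (Hs : 0 < s) by (apply Rdiv_lt_0_compat; [repeat apply Rmin_pos; auto|lra]).
  assert (Hs2 : s < Rmin (Rmin d delta) (Rmin d1 d2)) by (unfold s in *; lra).
  clearbody s.
  apply Rmin_Rgt in Hs2 as [S1 S2]. apply Rmin_Rgt in S1 as [S1 S1'].
  apply Rmin_Rgt in S2 as [S2 S2'].
  exists (z0 + s * u)%C.
  assert (Dz : Cmod (z0 + s * u - z0) = s).
  { replace (z0 + s * u - z0)%C with (s * u)%C by ring.
    rewrite Cmod_mult, Hu, Cmod_R, Rabs_pos_eq; lra. }
  rewrite Dz. split; [lra|].
  set (z := (z0 + s * u)%C) in *.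
  specialize (E z ltac:(lra)). specialize (CV' z ltac:(lra)). specialize (NM z ltac:(lra)).
  assert (X : (M z0 * N z)%C = (N z0 * M z * (1 + s ^ m * (u ^ m * V z)))%C).
  { replace (M z0 * N z)%C with (N z0 * M z + F z)%C by (unfold F; ring).
    rewrite E. replace (z - z0)%C with (s * u)%C by (unfold z; ring).
    unfold V. rewrite Cpow_mult_l. field. auto. }
  rewrite <- !Cmod_mult. rewrite X, (Cmod_mult (N z0 * M z)%C).
  rewrite <- (Rmult_1_r (Cmod (N z0 * M z))) at 1. apply Rmult_lt_compat_l.
  { apply Cmod_gt_0, Cmult_neq_0; auto. }
  eapply Rlt_le_trans; [|apply re_le_Cmod].
  eapply Rlt_le_trans; [|apply Rle_abs].
  assert (Rv : v / 2 <= Re (u ^ m * V z)%C).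
  { replace (u ^ m * V z)%C with (RtoC v + u ^ m * (V z - V z0))%C
      by (rewrite <- EuV; ring).
    assert (Cmod (u ^ m * (V z - V z0)) < v / 2).
    { rewrite Cmod_mult, Cmod_pow, Hu, pow1. lra. }
    pose proof (re_le_Cmod (u ^ m * (V z - V z0))) as Q.
    pose proof (Rle_abs (- Re (u ^ m * (V z - V z0))%C)) as Q'. rewrite Rabs_Ropp in Q'.
    change (v / 2 <= v + Re (u ^ m * (V z - V z0))%C). lra. }
  replace (Re (1 + s ^ m * (u ^ m * V z))%C) with (1 + s ^ m * Re (u ^ m * V z)%C).
  2:{ rewrite <- re_scal_l, RtoC_pow. reflexivity. }
  assert (0 < s ^ m) by (apply pow_lt; auto).
  assert (0 < s ^ m * Re (u ^ m * V z)%C) by (apply Rmult_lt_0_compat; lra).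
  lra.
Qed.

(** A continuous function on a nonempty compact set of the plane attains its
    maximum: otherwise each point has a neighbourhood on which some value of the
    function on the set is not reached, and the best of finitely many such values
    contradicts itself. *)
Lemma attains_maximum (P : C -> Prop) (u : C -> R) (r : R) (z1 : C) :
  P z1 -> (forall z, P z -> Cmod z <= r) ->
  (forall z, ~ P z -> exists d, 0 < d /\ forall y, Cmod (y - z) < d -> ~ P y) ->
  (forall z, P z -> forall eps, 0 < eps -> exists d, 0 < d /\
     forall y, Cmod (y - z) < d -> Rabs (u y - u z) < eps) ->
  exists m, P m /\ forall z, P z -> u z <= u m.
Proof.
  intros P1 Pb Pc Cu. apply NNPP. intros NE.
  assert (A : forall t : C, exists x : R * C, 0 < fst x /\ P (snd x) /\
     forall y, Cmod (y - t) < fst x -> P y -> u y < u (snd x)).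
  { intros t. destruct (classic (P t)) as [Pt|Pt].
    - assert (B : exists z', P z' /\ u t < u z').
      { apply NNPP. intros N. apply NE. exists t. split; auto. intros z Pz.
        apply Rnot_lt_le. intros L. apply N. eauto. }
      destruct B as (z' & Pz' & L).
      destruct (Cu t Pt (u z' - u t)) as (d & Hd & H); [lra|].
      exists (d, z'). simpl. split; auto. split; auto. intros y Hy _.
      specialize (H y Hy). apply Rabs_def2 in H. lra.
    - destruct (Pc t Pt) as (d & Hd & H). exists (d, z1). simpl. split; auto.
      split; auto. intros y Hy Py. exfalso. apply (H y Hy Py). }
  pose (ch := fun t => proj1_sig (constructive_indefinite_description _ (A t))).
  assert (Hch : forall t, 0 < fst (ch t) /\ P (snd (ch t)) /\
     forall y, Cmod (y - t) < fst (ch t) -> P y -> u y < u (snd (ch t))).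
  { intros t. exact (proj2_sig (constructive_indefinite_description _ (A t))). }
  clearbody ch.
  assert (Hd : forall t, 0 < fst (ch t) / 2) by (intros t; destruct (Hch t); lra).
  pose (toC := fun t : Compactness.Tn 2 R => (fst t, fst (snd t)) : C).
  apply (compactness_list 2 (- r, (- r, tt)) (r, (r, tt))
    (fun t => mkposreal _ (Hd (toC t)))).
  intros (l & Hl).
  assert (Cover : forall y, P y -> exists t, In t l /\ u y < u (snd (ch (toC t)))).
  { intros y Py. destruct (Hl (fst y, (snd y, tt))) as ([t1 [t2 []]] & Ht & _ & Cl).
    - pose proof (Rmax_Cmod y) as Q. specialize (Pb y Py).
      pose proof (Rmax_l (Rabs (fst y)) (Rabs (snd y))).
      pose proof (Rmax_r (Rabs (fst y)) (Rabs (snd y))).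
      assert (Q1 : Rabs (fst y) <= r) by lra. assert (Q2 : Rabs (snd y) <= r) by lra.
      simpl. split; [|split]; auto; apply Rabs_le_between; auto.
    - exists (t1, (t2, tt)). split; auto. destruct (Hch (t1, t2)) as (H1 & H2 & H3).
      apply H3; auto. simpl in Cl. destruct Cl as (C1 & C2 & _).
      eapply Rle_lt_trans; [apply Cmod_2Rmax|].
      assert (R1 : Rmax (Rabs (fst (y - (t1, t2))%C)) (Rabs (snd (y - (t1, t2))%C))
                < fst (ch (t1, t2)) / 2).
      { apply Rmax_lub_lt; assumption. }
      assert (sqrt 2 < 2).
      { rewrite <- (sqrt_Rsqr 2) at 2 by lra. apply sqrt_lt_1; unfold Rsqr; lra. }
      assert (0 <= Rmax (Rabs (fst (y - (t1, t2))%C)) (Rabs (snd (y - (t1, t2))%C))).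
      { eapply Rle_trans; [apply Rabs_pos|apply Rmax_l]. }
      pose proof (sqrt_pos 2). nra. }
  assert (Best : forall l' : list (Compactness.Tn 2 R), l' = nil \/ exists t, In t l' /\
     forall t', In t' l' -> u (snd (ch (toC t'))) <= u (snd (ch (toC t)))).
  { clear. induction l' as [|a l' [->|(t & Ht & IH)]]; auto; right.
    - exists a. split; [left; auto|]. intros t' [->|[]]. lra.
    - destruct (Rle_dec (u (snd (ch (toC a)))) (u (snd (ch (toC t))))) as [L|L].
      + exists t. split; [right; auto|]. intros t' [<-|H]; auto.
      + exists a. split; [left; auto|]. intros t' [<-|H]; [lra|]. specialize (IH t' H). lra. }
  destruct (Best l) as [->|(t & Ht & IH)].
  - destruct (Cover z1 P1) as (t & [] & _).
  - destruct (Hch (toC t)) as (_ & Pt & _).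
    destruct (Cover _ Pt) as (t' & Ht' & L). specialize (IH t' Ht'). lra.
Qed.

Lemma Cmod_continuous (f : C -> C) (z : C) : Ccontinuous f z ->
  forall eps, 0 < eps -> exists d, 0 < d /\
  forall y, Cmod (y - z) < d -> Rabs (Cmod (f y) - Cmod (f z)) < eps.
Proof.
  intros H e He. destruct (H e He) as (d & Hd & H'). exists d. split; auto.
  intros y Hy. specialize (H' y Hy).
  pose proof (Cmod_triangle_sub (f y) (f z)). pose proof (Cmod_triangle_sub (f z) (f y)) as Q.
  rewrite Cmod_sub_sym in Q. apply Rabs_def1; lra.
Qed.

(** If |N/M| exceeded 1 somewhere, its maximum over a suitable closed disk would be
    attained in the interior, since near the boundary |N/M| is almost at most 1.
    Among the maximum points one of largest modulus is chosen: there N/M can be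
    neither locally constant, because this would give a maximum point farther
    out, nor can its modulus increase. *)
Lemma quotient_maximum_principle (N M : C -> C) :
  analytic_on (disk 1) N -> analytic_on (disk 1) M ->
  (forall z, disk 1 z -> M z <> RtoC 0) ->
  (forall eps, 0 < eps -> exists rho, rho < 1 /\ forall z, rho < Cmod z < 1 ->
     Cmod (N z) <= (1 + eps) * Cmod (M z)) ->
  forall z, disk 1 z -> Cmod (N z) <= Cmod (M z).
Proof.
  intros HN HM M0 Hb z1 Hz1. apply Rnot_lt_le. intros L.
  pose (G := fun z => (N z * / M z)%C).
  assert (EG : forall z, disk 1 z -> Cmod (N z) = Cmod (G z) * Cmod (M z)).
  { intros z Hz. rewrite <- Cmod_mult. f_equal. unfold G. field. auto. }
  assert (PM : forall z, disk 1 z -> 0 < Cmod (M z)).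
  { intros z Hz. apply Cmod_gt_0; auto. }
  assert (CG : forall z, disk 1 z -> Ccontinuous G z).
  { intros z Hz. apply Ccontinuous_mult; [apply (analytic_Ccontinuous (disk 1)); auto|].
    apply Ccontinuous_inv; auto. apply (analytic_Ccontinuous (disk 1)); auto. }
  assert (c1 : 1 < Cmod (G z1)).
  { apply Rmult_lt_reg_r with (Cmod (M z1)); auto. rewrite <- EG by auto. lra. }
  destruct (Hb ((Cmod (G z1) - 1) / 2)) as (rho & Hrho & Hb'); [lra|].
  assert (Out : forall z, disk 1 z -> Cmod (G z1) <= Cmod (G z) -> Cmod z <= rho).
  { intros z Hz Hge. apply Rnot_lt_le. intros Lz.
    specialize (Hb' z (conj Lz Hz)). rewrite EG in Hb' by auto.
    apply Rmult_le_reg_r in Hb'; auto. lra. }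
  assert (In1 : forall z, Cmod z <= rho -> disk 1 z) by (unfold disk; intros; lra).
  destruct (attains_maximum (fun z => Cmod z <= rho) (fun z => Cmod (G z)) rho z1)
    as (m0 & Hm0 & Max0).
  { apply Out; auto. lra. }
  { auto. }
  { intros z Hz. exists (Cmod z - rho). split; [lra|]. intros y Hy Hy'.
    pose proof (Cmod_triangle_sub z y) as T. rewrite Cmod_sub_sym in T. lra. }
  { intros z Hz. apply Cmod_continuous, CG, In1; auto. }
  assert (G1 : Cmod (G z1) <= Cmod (G m0)) by (apply Max0, Out; auto; lra).
  destruct (attains_maximum (fun z => Cmod z <= rho /\ Cmod (G m0) <= Cmod (G z)) Cmod rho m0)
    as (m1 & (Hm1 & Hm1') & Max1).
  { split; auto; lra. }
  { tauto. }
  { intros z Hz. destruct (Rle_dec (Cmod z) rho) as [A|A].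
    - assert (B : Cmod (G z) < Cmod (G m0)) by (apply Rnot_le_lt; tauto).
      destruct (Cmod_continuous G z (CG z (In1 z A)) (Cmod (G m0) - Cmod (G z))) as (d & Hd & H).
      { lra. }
      exists d. split; auto. intros y Hy (_ & Q). specialize (H y Hy).
      apply Rabs_def2 in H. lra.
    - exists (Cmod z - rho). split; [lra|]. intros y Hy (Hy' & _).
      pose proof (Cmod_triangle_sub z y) as T. rewrite Cmod_sub_sym in T. lra. }
  { intros z _. apply (Cmod_continuous (fun z => z)). apply Ccontinuous_id. }
  assert (D1 : disk 1 m1) by auto.
  assert (Nm1 : N m1 <> RtoC 0).
  { apply Cmod_gt_0. rewrite EG by auto. apply Rmult_lt_0_compat; auto. lra. }
  (* Outside the closed disk of radius rho the boundary estimate keeps |G| below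
     the maximum, so that [m1] is a maximum point over the whole unit disk. *)
  assert (Glob : forall z, disk 1 z -> Cmod (G z) <= Cmod (G m1)).
  { intros z Hz. destruct (Rle_dec (Cmod z) rho) as [A|A].
    - specialize (Max0 z A). lra.
    - apply Rnot_lt_le. intros B. apply A, Out; auto. lra. }
  destruct (quotient_local_maximum (disk 1) N M m1 HN HM D1 (M0 m1 D1) Nm1)
    as [(d & Hd & E)|Inc].
  - set (s := Rmin d (1 - rho) / 2).
    assert (Hs : 0 < s) by (apply Rdiv_lt_0_compat; [apply Rmin_pos; lra|lra]).
    assert (Hs2 : s < Rmin d (1 - rho)) by (unfold s in *; lra). clearbody s.
    apply Rmin_Rgt in Hs2 as [S1 S2].
    assert (Hdir : exists e : C, Cmod e = 1 /\ Cmod m1 + s = Cmod (m1 + s * e)).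
    { destruct (Ceq_dec m1 0) as [->|Nm].
      - exists (RtoC 1). rewrite Cmod_1, Cmod_0. split; auto.
        replace (0 + s * 1)%C with (RtoC s) by ring. rewrite Cmod_R, Rabs_pos_eq; lra.
      - assert (P : 0 < Cmod m1) by (apply Cmod_gt_0; auto).
        assert (Nr : RtoC (Cmod m1) <> RtoC 0).
        { apply Cmod_gt_0. rewrite Cmod_R, Rabs_pos_eq; lra. }
        exists (m1 / Cmod m1)%C. split.
        + rewrite Cmod_div, Cmod_R, Rabs_pos_eq by (auto; lra). field. lra.
        + replace (m1 + s * (m1 / Cmod m1))%C with ((1 + s / Cmod m1)%R * m1)%C.
          * rewrite Cmod_mult, Cmod_R, Rabs_pos_eq.
            -- field. lra.
            -- apply Rplus_le_le_0_compat; [lra|]. apply Rlt_le, Rdiv_lt_0_compat; auto.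
          * rewrite RtoC_plus, RtoC_div by lra. field. auto. }
    destruct Hdir as (e & He & Hmod). set (z := (m1 + s * e)%C) in *.
    assert (Dz : Cmod (z - m1) < d).
    { unfold z. replace (m1 + s * e - m1)%C with (s * e)%C by ring.
      rewrite Cmod_mult, He, Cmod_R, Rabs_pos_eq; lra. }
    assert (Uz : disk 1 z) by (unfold disk; lra).
    specialize (E z Dz).
    assert (Gz : G z = G m1).
    { unfold G. replace (N z) with (M m1 * N z / M m1)%C by (field; auto).
      rewrite E. field. auto. }
    assert (Cmod z <= rho) by (apply Out; auto; rewrite Gz; lra).
    specialize (Max1 z ltac:(rewrite Gz; lra)). lra.
  - destruct (Inc (1 - rho)) as (z & Hz & L'); [lra|].
    assert (Uz : disk 1 z).
    { unfold disk. pose proof (Cmod_triangle_sub z m1). lra. }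
    rewrite (EG z Uz), (EG m1 D1) in L'. specialize (Glob z Uz).
    assert (0 < Cmod (M m1) * Cmod (M z)) by (apply Rmult_lt_0_compat; auto).
    nra.
Qed.

Lemma Cmod_sq (z : C) : Cmod z ^ 2 = fst z ^ 2 + snd z ^ 2.
Proof. exact (Cmod2_alt z). Qed.

Lemma Cmod_le_sq (z : C) (r : R) : 0 <= r -> Cmod z ^ 2 <= r ^ 2 -> Cmod z <= r.
Proof. intros Hr H. apply Rnot_lt_le. intros L. pose proof (Cmod_ge_0 z). nra. Qed.

(** * Lemmas of Schwarz and Pick *)

(** In particular the Blaschke factor (z - w)/(1 - conj w z) tends to modulus 1
    as |z| tends to 1. *)
Lemma blaschke_identity (z w : C) :
  Cmod (1 - Cconj w * z) ^ 2 = Cmod (z - w) ^ 2 + (1 - Cmod z ^ 2) * (1 - Cmod w ^ 2).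
Proof.
  rewrite !Cmod_sq. destruct z as [x y], w as [a b]. simpl. ring.
Qed.

(** Since the Blaschke factor has modulus close to 1 near the unit circle, dividing
    by it does not spoil the boundary estimate of the maximum principle. *)
Lemma divide_blaschke (N M K : C -> C) (z0 : C) :
  analytic_on (disk 1) K -> analytic_on (disk 1) M ->
  (forall z, disk 1 z -> M z <> RtoC 0) ->
  disk 1 z0 ->
  (forall z, disk 1 z -> N z = ((z - z0) * K z)%C) ->
  (forall z, disk 1 z -> Cmod (N z) <= Cmod (M z)) ->
  forall z, disk 1 z -> Cmod ((1 - Cconj z0 * z) * K z) <= Cmod (M z).
Proof.
  intros HK HM M0 Hz0 EN HNM.
  apply (quotient_maximum_principle (fun z => (1 - Cconj z0 * z) * K z)%C M); auto.
  { apply analytic_ext with (fun z => K z + - Cconj z0 * (z * K z))%C; [intros; ring|].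
    apply analytic_plus; auto. apply analytic_scal, analytic_mult_id; auto. }
  intros eps He. unfold disk in Hz0.
  set (d := (1 - Cmod z0) / 2). assert (Hd : 0 < d) by (unfold d; lra).
  set (e := Rmin d (eps * d ^ 2)).
  assert (Hd2 : 0 < d ^ 2) by (apply pow_lt; auto).
  assert (P2 : 0 < eps * d ^ 2) by (apply Rmult_lt_0_compat; auto).
  assert (He' : 0 < e) by (apply Rmin_pos; auto).
  exists (1 - e). split; [lra|]. intros z (Hz1 & Hz2).
  assert (A1 : 1 - Cmod z < d) by (pose proof (Rmin_l d (eps * d ^ 2)) as Q; fold e in Q; lra).
  assert (A2 : 1 - Cmod z < eps * d ^ 2) by (pose proof (Rmin_r d (eps * d ^ 2)) as Q; fold e in Q; lra).
  assert (B : d <= Cmod (z - z0)).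
  { pose proof (Cmod_triangle_sub z z0). unfold d in *. lra. }
  assert (Bl : Cmod (1 - Cconj z0 * z) <= (1 + eps) * Cmod (z - z0)).
  { apply Cmod_le_sq.
    - apply Rmult_le_pos; [lra|apply Cmod_ge_0].
    - rewrite blaschke_identity, Rpow_mult_distr.
      pose proof (Cmod_ge_0 z) as Pz. pose proof (Cmod_ge_0 z0) as Pz0.
      assert (C1 : (1 - Cmod z ^ 2) * (1 - Cmod z0 ^ 2) <= 2 * (1 - Cmod z)).
      { apply Rle_trans with ((2 * (1 - Cmod z)) * 1); [|lra].
        apply Rmult_le_compat; nra. }
      assert (C2 : d ^ 2 <= Cmod (z - z0) ^ 2) by (apply pow_incr; lra).
      nra. }
  apply Rmult_le_reg_l with (Cmod (z - z0)); [lra|].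
  rewrite Cmod_mult.
  apply Rle_trans with (Cmod (1 - Cconj z0 * z) * Cmod (N z)).
  { rewrite EN, Cmod_mult by exact Hz2. right. ring. }
  apply Rle_trans with ((1 + eps) * Cmod (z - z0) * Cmod (M z)); [|right; ring].
  apply Rmult_le_compat; try apply Cmod_ge_0; auto.
Qed.

(** Remove the [n] zeros at the origin one by one with [divide_blaschke]. *)
Lemma schwarz_order (N M N1 : C -> C) (n : nat) :
  analytic_on (disk 1) N1 -> analytic_on (disk 1) M ->
  (forall z, disk 1 z -> M z <> RtoC 0) ->
  (forall z, disk 1 z -> N z = (z ^ n * N1 z)%C) ->
  (forall z, disk 1 z -> Cmod (N z) <= Cmod (M z)) ->
  forall z, disk 1 z -> Cmod (N1 z) <= Cmod (M z).
Proof.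
  intros H1 HM M0. revert N. induction n; intros N EN HNM.
  - intros z Hz. specialize (HNM z Hz). rewrite EN in HNM by auto.
    simpl in HNM. rewrite Cmult_1_l in HNM. exact HNM.
  - apply (IHn (fun z => z ^ n * N1 z)%C); auto.
    assert (D0 : disk 1 (RtoC 0)) by (unfold disk; rewrite Cmod_0; lra).
    assert (HK : analytic_on (disk 1) (fun z => z ^ n * N1 z)%C).
    { clear - H1. induction n.
      - apply analytic_ext with N1; auto. intros; simpl; ring.
      - apply analytic_ext with (fun z => z * (z ^ n * N1 z))%C; [intros; simpl; ring|].
        apply analytic_mult_id; auto. }
    intros z Hz.
    pose proof (divide_blaschke N M (fun z => z ^ n * N1 z)%C (RtoC 0) HK HM M0 D0) as Q.
    replace (z ^ n * N1 z)%C with ((1 - Cconj 0 * z) * (z ^ n * N1 z))%C.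
    + apply Q; auto. intros w Hw. rewrite EN by auto. simpl. ring.
    + replace (Cconj 0) with (RtoC 0); [ring|].
      unfold Cconj, RtoC. simpl. f_equal. ring.
Qed.

(** This is the invariance of the pseudo-hyperbolic distance for the functions
    a/(t b) and c/(t d), cleared of denominators. *)
Lemma pick_identity (a b c d : C) (t : R) :
  (t ^ 2 * Cmod b ^ 2 - Cmod a ^ 2) * (t ^ 2 * Cmod d ^ 2 - Cmod c ^ 2) =
  Cmod (t ^ 2 * Cconj d * b - Cconj c * a) ^ 2 - t ^ 2 * Cmod (d * a - c * b) ^ 2.
Proof.
  rewrite <- RtoC_pow. rewrite !Cmod_sq.
  destruct a, b, c, d. simpl. ring.
Qed.

(** This is |phi'| (1 - |z|^2) <= 1 - |phi|^2 for phi = N/M, cleared of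
    denominators.  The function phi is first replaced by phi/t with t > 1, so that
    its modulus stays below 1 and the denominator of the pseudo-hyperbolic
    quotient has no zero; dividing that quotient by the Blaschke factor of [z0]
    and evaluating at [z0] gives the inequality for t, and t tends to 1. *)
Lemma schwarz_pick (N M : C -> C) (z0 dN dM : C) :
  analytic_on (disk 1) N -> analytic_on (disk 1) M ->
  (forall z, disk 1 z -> M z <> RtoC 0) ->
  (forall z, disk 1 z -> Cmod (N z) <= Cmod (M z)) ->
  disk 1 z0 -> is_Cderive N z0 dN -> is_Cderive M z0 dM ->
  Cmod (M z0 * dN - N z0 * dM) * (1 - Cmod z0 ^ 2) <= Cmod (M z0) ^ 2 - Cmod (N z0) ^ 2.
Proof.
  intros HN HM M0 HNM Hz0 DN DM.
  pose (F := fun z => (M z0 * N z + - N z0 * M z)%C).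
  assert (HF : analytic_on (disk 1) F) by (apply analytic_plus; apply analytic_scal; auto).
  destruct (analytic_divide (disk 1) F z0 HF Hz0) as (K & HK & EK).
  { unfold F. ring. }
  assert (K0 : K z0 = (M z0 * dN - N z0 * dM)%C).
  { apply (is_Cderive_unique F z0).
    - exists K. split; [apply (analytic_Ccontinuous (disk 1)); auto|]. split; auto.
      intros z. replace (F z0) with (RtoC 0) by (unfold F; ring). rewrite EK. ring.
    - unfold F.
      replace (M z0 * dN - N z0 * dM)%C
        with ((0 * N z0 + M z0 * dN) + (0 * M z0 + - N z0 * dM))%C by ring.
      apply is_Cderive_plus; apply (is_Cderive_mult (fun _ => _)); auto; apply is_Cderive_const. }
  rewrite <- K0.
  assert (P0 : 0 < Cmod (M z0)) by (apply Cmod_gt_0; auto).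
  assert (Bt : forall t, 1 < t ->
    t * (Cmod (K z0) * (1 - Cmod z0 ^ 2)) <= t ^ 2 * Cmod (M z0) ^ 2 - Cmod (N z0) ^ 2).
  { intros t Ht.
    pose (D := fun z => (t ^ 2 * Cconj (M z0) * M z + - Cconj (N z0) * N z)%C).
    assert (HD : analytic_on (disk 1) D) by (apply analytic_plus; apply analytic_scal; auto).
    assert (D0 : forall z, disk 1 z -> D z <> RtoC 0).
    { intros z Hz A. specialize (HNM z Hz) as Q. specialize (HNM z0 Hz0).
      assert (E : (t ^ 2 * Cconj (M z0) * M z)%C = (Cconj (N z0) * N z)%C).
      { apply Ceq_minus. rewrite <- A. unfold D. ring. }
      assert (E' : t ^ 2 * (Cmod (M z0) * Cmod (M z)) = Cmod (N z0) * Cmod (N z)).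
      { apply (f_equal Cmod) in E. rewrite !Cmod_mult, !Cmod_conj, <- RtoC_pow in E.
        rewrite Cmod_R, Rabs_pos_eq in E by (apply pow_le; lra). lra. }
      assert (PM : 0 < Cmod (M z)) by (apply Cmod_gt_0; auto).
      assert (Cmod (N z0) * Cmod (N z) <= Cmod (M z0) * Cmod (M z)).
      { apply Rmult_le_compat; auto; apply Cmod_ge_0. }
      assert (0 < Cmod (M z0) * Cmod (M z)) by (apply Rmult_lt_0_compat; auto).
      assert (1 < t ^ 2) by nra.
      set (X := Cmod (M z0) * Cmod (M z)) in *. nra. }
    assert (S : forall y, disk 1 y -> 0 <= t ^ 2 * Cmod (M y) ^ 2 - Cmod (N y) ^ 2).
    { intros y Hy. specialize (HNM y Hy).
      assert (Cmod (N y) ^ 2 <= Cmod (M y) ^ 2).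
      { apply pow_incr. split; [apply Cmod_ge_0|auto]. }
      assert (0 <= Cmod (M y) ^ 2) by (apply pow_le, Cmod_ge_0).
      assert (1 < t ^ 2) by nra.
      set (X := Cmod (M y) ^ 2) in *. nra. }
    assert (Bz : forall z, disk 1 z -> Cmod (t * F z) <= Cmod (D z)).
    { intros z Hz. apply Cmod_le_sq; [apply Cmod_ge_0|].
      rewrite Cmod_mult, Cmod_R, Rabs_pos_eq by lra. rewrite Rpow_mult_distr.
      pose proof (pick_identity (N z) (M z) (N z0) (M z0) t) as Q.
      replace (D z) with (t ^ 2 * Cconj (M z0) * M z - Cconj (N z0) * N z)%C by (unfold D; ring).
      replace (F z) with (M z0 * N z - N z0 * M z)%C by (unfold F; ring).
      pose proof (Rmult_le_pos _ _ (S z Hz) (S z0 Hz0)). lra. }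
    pose proof (divide_blaschke (fun z => t * F z)%C D (fun z => t * K z)%C z0) as Q.
    specialize (Q (analytic_scal _ _ _ HK) HD D0 Hz0).
    specialize (Q ltac:(intros; cbv beta; rewrite EK; ring) Bz z0 Hz0).
    rewrite !Cmod_mult, Cmod_R, Rabs_pos_eq in Q by lra.
    assert (E1 : Cmod (1 - Cconj z0 * z0) = 1 - Cmod z0 ^ 2).
    { replace (1 - Cconj z0 * z0)%C with (RtoC (1 - Cmod z0 ^ 2)).
      - rewrite Cmod_R, Rabs_pos_eq; auto. unfold disk in Hz0.
        pose proof (Cmod_ge_0 z0). nra.
      - rewrite RtoC_minus, Cmod2_conj. ring. }
    assert (E2 : Cmod (D z0) = t ^ 2 * Cmod (M z0) ^ 2 - Cmod (N z0) ^ 2).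
    { replace (D z0) with (RtoC (t ^ 2 * Cmod (M z0) ^ 2 - Cmod (N z0) ^ 2)).
      - rewrite Cmod_R, Rabs_pos_eq; auto.
      - rewrite RtoC_minus, RtoC_mult, !Cmod2_conj, RtoC_pow. unfold D. ring. }
    rewrite E1, E2 in Q. lra. }
  apply Rnot_lt_le. intros L.
  set (X := Cmod (K z0) * (1 - Cmod z0 ^ 2)) in *.
  set (m := Cmod (M z0) ^ 2) in *. set (k := Cmod (N z0) ^ 2) in *.
  assert (Pm : 0 < m) by (apply pow_lt; auto).
  assert (Pk : k <= m).
  { apply pow_incr. split; [apply Cmod_ge_0|auto]. }
  (* With t = 1 + eta one has t^2 - 1 <= 3 eta, so this eta makes the excess
     (t^2 - 1) m smaller than X - (m - k). *)
  set (eta := Rmin 1 ((X - (m - k)) / (4 * m))).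
  assert (He : 0 < eta) by (apply Rmin_pos; [lra|apply Rdiv_lt_0_compat; lra]).
  assert (He1 : eta <= 1) by apply Rmin_l.
  assert (He2 : eta * (4 * m) <= X - (m - k)).
  { apply Rle_trans with ((X - (m - k)) / (4 * m) * (4 * m)).
    - apply Rmult_le_compat_r; [lra|apply Rmin_r].
    - right. field. lra. }
  specialize (Bt (1 + eta) ltac:(lra)).
  clearbody eta m X k. nra.
Qed.

(** * Functions of positive real part *)

Lemma pow_bernoulli_bound (q : R) (n : nat) :
  0 <= q <= 1 -> q ^ n * (1 + INR n * (1 - q)) <= 1.
Proof.
  intros Hq. induction n.
  - simpl. lra.
  - rewrite S_INR. simpl.
    assert (P : 0 <= q ^ n) by (apply pow_le; lra).
    pose proof (pos_INR n) as Pn.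
    assert (0 <= INR n * (1 - q)) by (apply Rmult_le_pos; lra).
    assert (q * (1 + (INR n + 1) * (1 - q)) <= 1 + INR n * (1 - q)) by nra.
    apply Rle_trans with (q ^ n * (1 + INR n * (1 - q))); auto.
    replace (q * q ^ n * (1 + (INR n + 1) * (1 - q)))
      with (q ^ n * (q * (1 + (INR n + 1) * (1 - q)))) by ring.
    apply Rmult_le_compat_l; auto.
Qed.

(** Divided by 1 - r^2 this says that 2 (r + r^3 + ... + r^(2n-1)) is at most
    n (1 + r^(2n)).  The step of the induction on n is [pow_bernoulli_bound] for
    q = r^2, because 2 r <= 1 + q. *)
Lemma geometric_symmetric_bound (r : R) (n : nat) :
  0 <= r <= 1 ->
  2 * r * (1 - (r ^ n) ^ 2) <= INR n * (1 + (r ^ n) ^ 2) * (1 - r ^ 2).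
Proof.
  intros Hr. rewrite <- !pow_mult, !(Nat.mul_comm n 2), !pow_mult.
  set (q := r ^ 2). assert (Hq : 0 <= q <= 1) by (unfold q; nra).
  assert (Hqr : 2 * r <= 1 + q) by (unfold q; nra). clearbody q.
  induction n.
  - simpl. lra.
  - rewrite S_INR. pose proof (pow_bernoulli_bound q n Hq) as Bn. simpl.
    assert (P : 0 <= q ^ n) by (apply pow_le; lra). set (y := q ^ n) in *.
    assert (I1 : 2 * r * y <= (1 + q) * y) by (apply Rmult_le_compat_r; auto).
    assert (I2 : 0 <= (1 - q) * (1 + q * y - INR n * y * (1 - q) - 2 * r * y)).
    { apply Rmult_le_pos; lra. }
    lra.
Qed.

Lemma is_Cderive_bound (f : C -> C) (z0 d : C) (L delta : R) :
  0 < delta -> is_Cderive f z0 d ->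
  (forall z, Cmod (z - z0) < delta -> Cmod (f z - f z0) <= L * Cmod (z - z0)) ->
  Cmod d <= L.
Proof.
  intros Hd (K & CK & EK & H) HL. apply Rnot_lt_le. intros A.
  destruct (CK (Cmod d - L)) as (e & He & HK); [lra|].
  set (s := Rmin e delta / 2).
  assert (Hs : 0 < s) by (apply Rdiv_lt_0_compat; [apply Rmin_pos; lra|lra]).
  assert (Hs2 : s < Rmin e delta) by (unfold s in *; lra). clearbody s.
  apply Rmin_Rgt in Hs2 as [S1 S2].
  assert (Dz : Cmod (z0 + s - z0) = s).
  { replace (z0 + s - z0)%C with (RtoC s) by ring. rewrite Cmod_R, Rabs_pos_eq; lra. }
  specialize (HK (z0 + s)%C ltac:(lra)). specialize (HL (z0 + s)%C ltac:(lra)).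
  rewrite H, Cmod_mult, Dz, EK in *.
  pose proof (Cmod_triangle_sub d (K (z0 + s)%C)) as T. rewrite Cmod_sub_sym in T.
  rewrite Rmult_comm in HL. apply Rmult_le_reg_r in HL; auto. lra.
Qed.

(** The quotient by z^n is again a power series, hence bounded near the origin. *)
Lemma pseries_remainder_order (f : C -> C) (a : nat -> C) (n : nat) :
  (1 <= n)%nat ->
  (forall z, z <> RtoC 0 -> disk 1 z ->
     is_cpseries a z (f z)) ->
  (forall k, (1 <= k < n)%nat -> a k = RtoC 0) ->
  exists K delta : R, 0 < delta /\ forall z, z <> RtoC 0 -> Cmod z < delta ->
    Cmod (f z - a 0%nat) <= K * Cmod z ^ n.
Proof.
  intros Hn Hf Ha. destruct n as [|n]; [lia|].
  pose (S := fun z => if Ceq_dec z 0 then a (1 + n)%nat else ((f z - a 0%nat) / z / z ^ n)%C).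
  assert (LS : locally_lipschitz S (RtoC 0)).
  { apply pseries_lipschitz with (fun k => a (1 + (n + k))%nat) 1; [lra|].
    intros z Hz. replace (z - 0)%C with z in * by ring. unfold S.
    destruct (Ceq_dec z 0) as [->|N].
    - pose proof (is_pseries_center (fun k => a (1 + (n + k))%nat)) as Q.
      simpl in Q. rewrite Nat.add_0_r in Q. exact Q.
    - apply (is_pseries_shift_n (fun k => a (1 + k)%nat)); auto.
      + intros k Hk. apply Ha. lia.
      + apply (is_pseries_shift a z (f z) N). apply Hf; auto. }
  destruct (Ccontinuous_bounded S (RtoC 0) (locally_lipschitz_Ccontinuous _ _ LS)) as (d & Hd & B).
  exists (Cmod (S (RtoC 0)) + 1), d. split; auto.
  intros z Nz Hz. specialize (B z). replace (z - 0)%C with z in B by ring. specialize (B Hz).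
  replace (f z - a 0%nat)%C with (S z * z ^ (1 + n))%C.
  - rewrite Cmod_mult, Cmod_pow. apply Rmult_le_compat_r; auto. apply pow_le, Cmod_ge_0.
  - unfold S. destruct (Ceq_dec z 0); [contradiction|]. simpl. field. split; auto.
    apply Cpow_nz; auto.
Qed.

Lemma disk0 : disk 1 (RtoC 0).
Proof. unfold disk. rewrite Cmod_0. lra. Qed.

(** It translates between Re p > 0 and |p - 1| < |p + 1|. *)
Lemma Cmod_plus1_minus1 (p : C) : Cmod (p + 1) ^ 2 - Cmod (p + - (1)) ^ 2 = 4 * Re p.
Proof. rewrite !Cmod_sq. destruct p as [u v]. simpl. ring. Qed.

Lemma disk_pow_lt1 (z : C) (n : nat) : (1 <= n)%nat -> disk 1 z -> 0 <= Cmod z ^ n < 1.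
Proof.
  intros Hn Hz. unfold disk in Hz. pose proof (Cmod_ge_0 z). split; [apply pow_le; auto|].
  apply pow_lt_1_compat; [split; auto|lia].
Qed.

(** Write p - 1 = z^n N1 and M = p + 1.  The Schwarz lemma gives |N1| <= |M|, and
    Schwarz-Pick bounds M N1' - N1 M'.  Since
    2 z p' = n (p - 1)(p + 1) + z^(n+1) (M N1' - N1 M') and
    4 Re p = |p + 1|^2 - |p - 1|^2, what remains is an inequality between real
    numbers, linear in |N1|/|M| after a common factor is removed. *)
Lemma class_P_logder_bound (n : nat) (p : C -> C) (z dp : C) :
  (1 <= n)%nat -> class_P n p -> disk 1 z -> z <> RtoC 0 -> is_Cderive p z dp ->
  Cmod (z * dp) * (1 - (Cmod z ^ n) ^ 2) <= 2 * INR n * Cmod z ^ n * Cmod (p z).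
Proof.
  intros Hn (Ap & (c & c0 & ck & Hc) & Rp) Hz Nz Dp.
  assert (Am : analytic_on (disk 1) (fun z => p z + - (1))%C).
  { apply analytic_plus; auto. apply (analytic_const _ (- (1))%C). }
  assert (AM : analytic_on (disk 1) (fun z => p z + 1)%C).
  { apply analytic_plus; auto. apply (analytic_const _ (RtoC 1)). }
  destruct (pseries_remainder_order p c n Hn (fun z _ H => Hc z H) ck) as (K & d & Hd & HK).
  destruct (analytic_divide_pow (disk 1) (fun z => p z + - (1))%C n K d disk0 Am Hd)
    as (N1 & A1 & E1).
  { intros w Nw Hw. specialize (HK w Nw Hw). rewrite c0 in HK. exact HK. }
  assert (M0 : forall w, disk 1 w -> (p w + 1)%C <> RtoC 0).
  { intros w Hw A. specialize (Rp w Hw). apply (f_equal Re) in A. simpl in A.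
    unfold Re in *. lra. }
  assert (NM : forall w, disk 1 w -> Cmod (p w + - (1)) <= Cmod (p w + 1)).
  { intros w Hw. apply Cmod_le_sq; [apply Cmod_ge_0|].
    pose proof (Cmod_plus1_minus1 (p w)). specialize (Rp w Hw). lra. }
  pose proof (schwarz_order _ (fun z => p z + 1)%C N1 n A1 AM M0 (fun w _ => E1 w) NM) as SO.
  destruct (analytic_is_Cderive (disk 1) N1 z A1 Hz) as (d1 & D1).
  assert (DM : is_Cderive (fun z => p z + 1)%C z dp).
  { replace dp with (dp + 0)%C by ring. apply is_Cderive_plus; auto. apply is_Cderive_const. }
  pose proof (schwarz_pick N1 (fun z => p z + 1)%C z d1 dp A1 AM M0 SO Hz D1 DM) as SP.
  cbv beta in SP.
  assert (Edp : dp = (INR n * z ^ pred n * N1 z + z ^ n * d1)%C).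
  { apply (is_Cderive_unique (fun z => p z + - (1))%C z).
    - replace dp with (dp + 0)%C by ring. apply is_Cderive_plus; auto. apply (is_Cderive_const (- (1))%C).
    - apply (is_Cderive_ext_loc (fun z => z ^ n * N1 z)%C _ z _ 1); [lra|intros; symmetry; apply E1|].
      apply is_Cderive_mult; auto. apply is_Cderive_pow. }
  set (x := Cmod z ^ n) in *. set (r := Cmod z) in *.
  assert (Hx : 0 <= x < 1) by (apply disk_pow_lt1; auto).
  assert (Hr : 0 <= r < 1) by (split; [apply Cmod_ge_0|exact Hz]).
  specialize (SO z Hz). cbv beta in SO.
  set (A := Cmod (p z + 1)) in *. set (Y := Cmod (N1 z)) in *.
  assert (PY : 0 <= Y) by apply Cmod_ge_0.
  assert (XY : Cmod (p z + - (1)) = x * Y).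
  { rewrite E1, Cmod_mult, Cmod_pow. reflexivity. }
  assert (RE : A ^ 2 - (x * Y) ^ 2 <= 4 * Cmod (p z)).
  { rewrite <- XY. unfold A. rewrite Cmod_plus1_minus1.
    pose proof (re_le_Cmod (p z)). pose proof (Rle_abs (Re (p z))). lra. }
  (* Substitute z^(n+1) N1' = z p' - n z^n N1 and z^n N1 = p - 1. *)
  assert (Key : (2 * (z * dp) = INR n * (p z + - (1)) * (p z + 1)
                 + z * z ^ n * ((p z + 1) * d1 - N1 z * dp))%C).
  { assert (Z : (z * z ^ n * d1 = z * dp - INR n * z ^ n * N1 z)%C).
    { rewrite Edp. destruct n; [lia|]. simpl pred. rewrite Cpow_S. ring. }
    transitivity (INR n * (p z + - (1)) * (p z + 1) + (p z + 1) * (z * z ^ n * d1)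
                 - z * dp * (z ^ n * N1 z))%C; [|ring].
    rewrite Z, <- E1.
    replace (INR n * z ^ n * N1 z)%C with (INR n * (z ^ n * N1 z))%C by ring.
    rewrite <- E1. ring. }
  assert (T : 2 * Cmod (z * dp) <=
     INR n * (x * Y) * A + r * x * Cmod ((p z + 1) * d1 - N1 z * dp)).
  { rewrite <- (Rabs_pos_eq 2), <- Cmod_R, <- Cmod_mult, Key by lra.
    eapply Rle_trans; [apply Cmod_triangle|]. apply Rplus_le_compat.
    - rewrite !Cmod_mult, XY, Cmod_R, Rabs_pos_eq by apply pos_INR. right. reflexivity.
    - rewrite !Cmod_mult, Cmod_pow. right. reflexivity. }
  set (W := Cmod ((p z + 1) * d1 - N1 z * dp)) in *.
  pose proof (geometric_symmetric_bound r n ltac:(lra)) as G. fold x in G.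
  set (D := Cmod (z * dp)) in *. pose proof (pos_INR n) as Pn. set (m := INR n) in *.
  assert (r2 : 0 < 1 - r ^ 2) by nra.
  assert (x2 : 0 < 1 - x ^ 2) by nra.
  apply Rmult_le_reg_l with (2 * (1 - r ^ 2)); [lra|].
  apply Rle_trans with ((1 - x ^ 2) * (m * (x * Y) * A * (1 - r ^ 2) + r * x * (A ^ 2 - Y ^ 2))).
  { apply Rle_trans with ((1 - x ^ 2) * ((2 * D) * (1 - r ^ 2))); [right; ring|].
    apply Rmult_le_compat_l; [lra|].
    apply Rle_trans with ((m * (x * Y) * A + r * x * W) * (1 - r ^ 2)).
    - apply Rmult_le_compat_r; lra.
    - assert (r * x * (W * (1 - r ^ 2)) <= r * x * (A ^ 2 - Y ^ 2)).
      { apply Rmult_le_compat_l; auto. apply Rmult_le_pos; lra. }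
      lra. }
  apply Rle_trans with (x * m * (1 - r ^ 2) * (A ^ 2 - (x * Y) ^ 2)).
  2:{ assert (0 <= x * m * (1 - r ^ 2)) by (repeat apply Rmult_le_pos; lra).
      apply Rle_trans with (x * m * (1 - r ^ 2) * (4 * Cmod (p z)));
        [apply Rmult_le_compat_l; auto|right; ring]. }
  assert (I1 : (A + Y) * (2 * r * (1 - x ^ 2)) <= (A + Y) * (m * (1 + x ^ 2) * (1 - r ^ 2))).
  { apply Rmult_le_compat_l; lra. }
  (* The difference of the two sides is (A - Y) (1 - x^2), nonnegative as Y <= A. *)
  assert (I2 : (A + Y) * (1 + x ^ 2) <= 2 * (A + x ^ 2 * Y)) by nra.
  assert (I3 : (m * (1 - r ^ 2)) * ((A + Y) * (1 + x ^ 2)) <= (m * (1 - r ^ 2)) * (2 * (A + x ^ 2 * Y))).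
  { apply Rmult_le_compat_l; auto. apply Rmult_le_pos; lra. }
  assert (I4 : 0 <= x * (A - Y) * (m * (1 - r ^ 2) * (A + x ^ 2 * Y) - (A + Y) * (r * (1 - x ^ 2)))).
  { repeat apply Rmult_le_pos; lra. }
  lra.
Qed.

(** * Starlike functions *)

Lemma analytic_derivative_locally_bounded (U : C -> Prop) (f : C -> C) (z0 : C) :
  analytic_on U f -> U z0 -> exists delta L : R, 0 < delta /\
  forall z d, Cmod (z - z0) < delta -> is_Cderive f z d -> Cmod d <= L.
Proof.
  intros Hf Hz. destruct (analytic_lipschitz U f z0 Hf Hz) as (d & L & Hd & HL & H).
  exists d, L. split; auto. intros z dz Hzz D.
  apply (is_Cderive_bound f z dz L (d - Cmod (z - z0))); auto; [lra|].
  intros w Hw. apply H; auto.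
  replace (w - z0)%C with ((w - z) + (z - z0))%C by ring.
  eapply Rle_lt_trans; [apply Cmod_triangle|]. lra.
Qed.

Lemma zlogder_neq0 (g : C -> C) (z d : C) :
  z <> RtoC 0 -> is_Cderive g z d -> zlogder g z = (z * d / g z)%C.
Proof.
  intros Nz D. unfold zlogder, fill1. destruct (Ceq_dec z 0); [contradiction|].
  rewrite (is_Cderive_C_derive g z d D). reflexivity.
Qed.

(** With g = z (1 + z^n T) one has
    z g'/g - 1 = z^n (n T + z T')/(1 + z^n T), and T and its derivative are bounded
    near the origin. *)
Lemma class_A_zlogder_order (n : nat) (g : C -> C) :
  (1 <= n)%nat -> class_A n g ->
  exists K delta : R, 0 < delta /\ forall z, z <> RtoC 0 -> Cmod z < delta ->
    Cmod (zlogder g z + - (1)) <= K * Cmod z ^ n.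
Proof.
  intros Hn (Ag & a & a0 & a1 & ak & Ha).
  destruct (pseries_remainder_order (fun z => g z / z)%C (fun k => a (S k)) n Hn)
    as (K & d & Hd & HK).
  { intros z Nz Hz. pose proof (is_pseries_shift a z (g z) Nz (Ha z Hz)) as Q.
    rewrite a0 in Q. replace (g z - 0)%C with (g z) in Q by ring. exact Q. }
  { intros k Hk. apply ak. lia. }
  rewrite a1 in HK.
  assert (AF : analytic_on (disk 1) (fun z => g z + (- (1)) * z)%C).
  { apply analytic_plus; auto. apply analytic_scal, analytic_id. }
  destruct (analytic_divide_pow (disk 1) _ (S n) K d disk0 AF Hd) as (T & AT & ET).
  { intros z Nz Hz. specialize (HK z Nz Hz).
    replace (g z + - (1) * z)%C with (z * (g z / z - 1))%C by (field; auto).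
    rewrite Cmod_mult. simpl. replace (K * (Cmod z * Cmod z ^ n)) with (Cmod z * (K * Cmod z ^ n)) by ring.
    apply Rmult_le_compat_l; auto. apply Cmod_ge_0. }
  destruct (Ccontinuous_bounded T (RtoC 0) (analytic_Ccontinuous _ T _ AT disk0)) as (d1 & Hd1 & B1).
  destruct (analytic_derivative_locally_bounded (disk 1) T (RtoC 0) AT disk0) as (d2 & L & Hd2 & B2).
  set (K1 := Cmod (T (RtoC 0)) + 1) in *.
  assert (PK1 : 1 <= K1) by (pose proof (Cmod_ge_0 (T (RtoC 0))); unfold K1; lra).
  exists (2 * (INR n * K1 + L)), (Rmin (Rmin d1 d2) (1 / (2 * K1))).
  split.
  { repeat apply Rmin_pos; auto. apply Rdiv_lt_0_compat; lra. }
  intros z Nz Hz. apply Rmin_Rgt in Hz as [Hz H3]. apply Rmin_Rgt in Hz as [H1 H2].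
  assert (H3' : Cmod z * K1 <= 1 / 2).
  { apply Rle_trans with (1 / (2 * K1) * K1); [apply Rmult_le_compat_r; lra|].
    right. field. lra. }
  assert (H4 : Cmod z < 1) by (pose proof (Cmod_ge_0 z); nra).
  assert (Hz : disk 1 z) by exact H4.
  specialize (B1 z). replace (z - 0)%C with z in B1 by ring. specialize (B1 H1).
  destruct (analytic_is_Cderive (disk 1) T z AT Hz) as (dT & DT).
  specialize (B2 z dT). replace (z - 0)%C with z in B2 by ring. specialize (B2 H2 DT).
  assert (Eg : forall w, g w = (w + w ^ (S n) * T w)%C).
  { intros w. rewrite <- ET. ring. }
  assert (Dg : is_Cderive g z (1 + (INR (S n) * z ^ n * T z + z ^ (S n) * dT))%C).
  { apply (is_Cderive_ext_loc (fun z => z + z ^ (S n) * T z)%C g z _ 1); [lra|auto|].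
    apply is_Cderive_plus; [apply is_Cderive_id|]. apply is_Cderive_mult; auto. apply (is_Cderive_pow z (S n)). }
  rewrite (zlogder_neq0 g z _ Nz Dg).
  assert (Sm : Cmod (z ^ n * T z) <= 1 / 2).
  { rewrite Cmod_mult, Cmod_pow. eapply Rle_trans; [|exact H3'].
    apply Rmult_le_compat; auto; try apply Cmod_ge_0.
    - apply pow_le, Cmod_ge_0.
    - destruct n; [lia|]. simpl. apply Rle_trans with (Cmod z * 1); [|lra].
      apply Rmult_le_compat_l; [apply Cmod_ge_0|]. rewrite <- (pow1 n). apply pow_incr.
      split; [apply Cmod_ge_0|lra]. }
  assert (Dn : 1 / 2 <= Cmod (1 + z ^ n * T z)).
  { pose proof (Cmod_triangle_sub 1 (- (z ^ n * T z))) as Q. rewrite Cmod_opp, Cmod_1 in Q.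
    replace (1 - - (z ^ n * T z))%C with (1 + z ^ n * T z)%C in Q by ring. lra. }
  assert (Nn : (1 + z ^ n * T z)%C <> RtoC 0) by (apply Cmod_gt_0; lra).
  rewrite Eg.
  replace (z * (1 + (INR (S n) * z ^ n * T z + z ^ S n * dT)) / (z + z ^ S n * T z) + - (1))%C
    with (z ^ n * (INR n * T z + z * dT) / (1 + z ^ n * T z))%C.
  2:{ rewrite S_INR, RtoC_plus, Cpow_S.
      replace (z + z * z ^ n * T z)%C with (z * (1 + z ^ n * T z))%C by ring.
      field. auto. }
  rewrite Cmod_div, Cmod_mult, Cmod_pow by auto.
  assert (Nu : Cmod (INR n * T z + z * dT) <= INR n * K1 + L).
  { eapply Rle_trans; [apply Cmod_triangle|]. rewrite !Cmod_mult, Cmod_R, Rabs_pos_eq by apply pos_INR.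
    apply Rplus_le_compat.
    - apply Rmult_le_compat_l; auto. apply pos_INR.
    - rewrite <- (Rmult_1_l L). apply Rmult_le_compat; auto; try apply Cmod_ge_0. lra. }
  apply Rmult_le_reg_r with (Cmod (1 + z ^ n * T z)); [lra|].
  unfold Rdiv. rewrite Rmult_assoc, Rinv_l, Rmult_1_r by lra.
  assert (P : 0 <= Cmod z ^ n) by apply pow_le, Cmod_ge_0.
  pose proof (Cmod_ge_0 (INR n * T z + z * dT)) as Pu.
  set (u := Cmod (INR n * T z + z * dT)) in *. set (V := INR n * K1 + L) in *.
  apply Rle_trans with (Cmod z ^ n * V).
  { apply Rmult_le_compat_l; auto. }
  replace (2 * V * Cmod z ^ n * Cmod (1 + z ^ n * T z))
    with (Cmod z ^ n * V * (2 * Cmod (1 + z ^ n * T z))) by ring.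
  rewrite <- (Rmult_1_r (Cmod z ^ n * V)) at 1. apply Rmult_le_compat_l; [|lra].
  apply Rmult_le_pos; lra.
Qed.

(** If q = (1 + (1 - 2 alpha) w)/(1 - w) then w = (q - 1)/(q + 1 - 2 alpha).  This
    quotient is bounded by 1 and vanishes to order [n] because q - 1 does. *)
Lemma class_ST_bound (n : nat) (alpha : R) (g : C -> C) (z : C) :
  (1 <= n)%nat -> 0 <= alpha < 1 -> class_ST n alpha g -> disk 1 z ->
  Cmod (zlogder g z - 1) <= Cmod z ^ n * Cmod (zlogder g z + RtoC (1 - 2 * alpha)).
Proof.
  intros Hn Hal (Ag & _ & Aq & w & Aw & w0 & wb & Ew) Hz.
  set (q := zlogder g) in *.
  assert (Am : analytic_on (disk 1) (fun z => q z + - (1))%C).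
  { apply analytic_plus; auto. apply (analytic_const _ (- (1))%C). }
  assert (AM : analytic_on (disk 1) (fun z => q z + RtoC (1 - 2 * alpha))%C).
  { apply analytic_plus; auto. apply (analytic_const _ (RtoC (1 - 2 * alpha))). }
  destruct (class_A_zlogder_order n g Hn Ag) as (K & d & Hd & HK).
  destruct (analytic_divide_pow (disk 1) (fun z => q z + - (1))%C n K d disk0 Am Hd HK)
    as (N1 & A1 & E1).
  assert (N1w : forall y, disk 1 y -> (1 - w y)%C <> RtoC 0).
  { intros y Hy A. specialize (wb y Hy).
    replace (w y) with (RtoC 1) in wb.
    - rewrite Cmod_1 in wb. lra.
    - apply Ceq_minus. exact A. }
  assert (EM : forall y, disk 1 y -> (q y + RtoC (1 - 2 * alpha) = RtoC (2 * (1 - alpha)) / (1 - w y))%C).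
  { intros y Hy. rewrite Ew by auto. rewrite !RtoC_mult, !RtoC_minus, !RtoC_mult. field. auto. }
  assert (EN : forall y, disk 1 y -> (q y + - (1) = w y * (q y + RtoC (1 - 2 * alpha)))%C).
  { intros y Hy. rewrite EM, Ew by auto. rewrite !RtoC_mult, !RtoC_minus, !RtoC_mult. field. auto. }
  assert (M0 : forall y, disk 1 y -> (q y + RtoC (1 - 2 * alpha))%C <> RtoC 0).
  { intros y Hy. rewrite EM by auto. apply Cmult_neq_0.
    - apply Cmod_gt_0. rewrite Cmod_R, Rabs_pos_eq; lra.
    - apply Cmod_gt_0. rewrite Cmod_inv by auto. apply Rinv_0_lt_compat, Cmod_gt_0. auto. }
  assert (NM : forall y, disk 1 y -> Cmod (q y + - (1)) <= Cmod (q y + RtoC (1 - 2 * alpha))).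
  { intros y Hy. rewrite EN, Cmod_mult by auto. specialize (wb y Hy).
    rewrite <- Rmult_1_l. apply Rmult_le_compat_r; [apply Cmod_ge_0|lra]. }
  pose proof (schwarz_order _ _ N1 n A1 AM M0 (fun w _ => E1 w) NM z Hz) as SO.
  change (q z - 1)%C with (q z + - (1))%C. rewrite E1, Cmod_mult, Cmod_pow.
  apply Rmult_le_compat_l; auto. apply pow_le, Cmod_ge_0.
Qed.

(** The points with ratio of distances to 1 and to 2 alpha - 1 at most x fill an
    Apollonius disk; the inequality is cleared of the denominator 1 - x^2. *)
Lemma apollonius_disk (q : C) (alpha x : R) :
  0 <= x < 1 -> alpha < 1 ->
  Cmod (q - 1) <= x * Cmod (q + RtoC (1 - 2 * alpha)) ->
  Cmod (RtoC (1 - x ^ 2) * q - RtoC (1 + (1 - 2 * alpha) * x ^ 2)) <= 2 * (1 - alpha) * x.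
Proof.
  intros Hx Ha H.
  assert (H2 : Cmod (q - 1) ^ 2 <= x ^ 2 * Cmod (q + RtoC (1 - 2 * alpha)) ^ 2).
  { rewrite <- Rpow_mult_distr. apply pow_incr. split; [apply Cmod_ge_0|auto]. }
  apply Cmod_le_sq.
  { apply Rmult_le_pos; lra. }
  assert (E : Cmod (RtoC (1 - x ^ 2) * q - RtoC (1 + (1 - 2 * alpha) * x ^ 2)) ^ 2 =
    (2 * (1 - alpha) * x) ^ 2 +
    (1 - x ^ 2) * (Cmod (q - 1) ^ 2 - x ^ 2 * Cmod (q + RtoC (1 - 2 * alpha)) ^ 2)).
  { rewrite !Cmod_sq. destruct q as [u v]. simpl. ring. }
  rewrite E. assert (0 < 1 - x ^ 2) by nra. nra.
Qed.

(** * Close-to-starlike functions and the lemniscate *)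

(** Add the bounds on z g'/g and z p'/p, both cleared of the denominator
    1 - x^2. *)
Lemma class_CS_zlogder_disk (n : nat) (alpha : R) (f : C -> C) (z : C) :
  (1 <= n)%nat -> 0 <= alpha < 1 -> class_CS n alpha f -> disk 1 z -> z <> RtoC 0 ->
  let x := Cmod z ^ n in
  Cmod (RtoC (1 - x ^ 2) * zlogder f z - RtoC (1 + (1 - 2 * alpha) * x ^ 2))
    <= 2 * (1 + INR n - alpha) * x.
Proof.
  intros Hn Hal ((Af & a & a0 & a1 & ak & Ha) & g & Hg & Hp) Hz Nz x.
  pose proof (class_ST_bound n alpha g z Hn Hal Hg Hz) as Bg.
  assert (Hx : 0 <= x < 1) by (apply disk_pow_lt1; auto).
  destruct Hg as ((Ag & b & b0 & b1 & bk & Hb) & Zg & _).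
  set (p := fill1 (fun z => (f z / g z)%C)) in *.
  pose proof Hp as (Ap & _ & Rp).
  destruct (analytic_is_Cderive _ p z Ap Hz) as (dp & Dp).
  destruct (analytic_is_Cderive _ g z Ag Hz) as (dg & Dg).
  pose proof (class_P_logder_bound n p z dp Hn Hp Hz Nz Dp) as Bp. fold x in Bp, Bg.
  assert (F0 : forall (h : C -> C) (c : nat -> C), c 0%nat = RtoC 0 -> (forall z, disk 1 z ->
     is_cpseries c z (h z)) -> h (RtoC 0) = RtoC 0).
  { intros h c c0 Hc. transitivity (c 0%nat); [|exact c0].
    apply (is_pseries_uniq c (RtoC 0)); [apply Hc, disk0|apply is_pseries_center]. }
  assert (Efgp : forall y, disk 1 y -> (g y * p y = f y)%C).
  { intros y Hy. unfold p, fill1. destruct (Ceq_dec y 0) as [->|N].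
    - rewrite (F0 f a a0 Ha), (F0 g b b0 Hb). ring.
    - field. apply Zg; auto. }
  assert (Df : is_Cderive f z (dg * p z + g z * dp)%C).
  { apply (is_Cderive_ext_loc (fun y => g y * p y)%C f z _ (1 - Cmod z)).
    - unfold disk in Hz. lra.
    - intros y Hy. apply Efgp. unfold disk. pose proof (Cmod_triangle_sub y z). lra.
    - apply is_Cderive_mult; auto. }
  assert (Np : p z <> RtoC 0).
  { intros A. specialize (Rp z Hz). rewrite A in Rp. simpl in Rp. unfold Re in Rp. simpl in Rp. lra. }
  assert (Ng : g z <> RtoC 0) by (apply Zg; auto).
  rewrite (zlogder_neq0 f z _ Nz Df), <- (Efgp z Hz).
  rewrite (zlogder_neq0 g z _ Nz Dg) in Bg.
  apply apollonius_disk in Bg; auto; [|lra].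
  set (e := (z * dp / p z)%C).
  replace (z * (dg * p z + g z * dp) / (g z * p z))%C with (z * dg / g z + e)%C
    by (unfold e; field; auto).
  set (q := (z * dg / g z)%C) in *.
  replace (RtoC (1 - x ^ 2) * (q + e) - RtoC (1 + (1 - 2 * alpha) * x ^ 2))%C
    with ((RtoC (1 - x ^ 2) * q - RtoC (1 + (1 - 2 * alpha) * x ^ 2)) + RtoC (1 - x ^ 2) * e)%C by ring.
  eapply Rle_trans; [apply Cmod_triangle|].
  assert (Cmod (RtoC (1 - x ^ 2) * e) <= 2 * INR n * x).
  { assert (0 < Cmod (p z)) by (apply Cmod_gt_0; auto).
    assert (0 <= 1 - x ^ 2) by nra.
    unfold e. rewrite Cmod_mult, Cmod_div, Cmod_R, Rabs_pos_eq by auto.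
    apply Rmult_le_reg_r with (Cmod (p z)); auto.
    unfold Rdiv. rewrite Rmult_assoc, (Rmult_assoc _ (/ _)), Rinv_l by lra. lra. }
  lra.
Qed.

(** With u = Re W and t = sqrt 2 - u the disk condition gives
    |W|^2 < 2 - 2 a t, and |W^2 - 1| < 1 means |W|^4 + 2 |W|^2 < 4 u^2.  Substituting
    leaves t (8 sqrt 2 - 12 a + 4 (a^2 - 1) t) < 0, where t < 2 (sqrt 2 - a). *)
Lemma disk_in_lemniscate (W : C) (a rho : R) :
  1 <= a -> 0 <= rho -> rho < sqrt 2 - a -> Cmod (W - RtoC a) <= rho ->
  Cmod (W ^ 2 - 1) < 1.
Proof.
  intros Ha Hrho Hlt H.
  set (s := sqrt 2) in *.
  assert (Hs : s ^ 2 = 2) by (unfold s; apply pow2_sqrt; lra).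
  assert (Ps : 0 <= s) by apply sqrt_pos.
  assert (Q : Cmod (W - RtoC a) ^ 2 <= rho ^ 2).
  { apply pow_incr. split; [apply Cmod_ge_0|auto]. }
  apply Rnot_le_lt. intros L.
  assert (L2 : 1 <= Cmod (W ^ 2 - 1) ^ 2).
  { apply Rle_trans with (1 ^ 2); [lra|]. apply pow_incr. lra. }
  rewrite Cmod_sq in Q, L2. destruct W as [u v]. simpl in Q, L2.
  clearbody s. clear L H.
  assert (Qa : (u - a) ^ 2 + v ^ 2 <= rho ^ 2) by (simpl; lra). clear Q.
  assert (L3 : 0 <= (u ^ 2 + v ^ 2) ^ 2 - 2 * (u ^ 2 - v ^ 2)).
  { match type of L2 with 1 <= ?x =>
      replace x with ((u ^ 2 + v ^ 2) ^ 2 - 2 * (u ^ 2 - v ^ 2) + 1) in L2 by ring end. lra. }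
  clear L2.
  assert (sB : s <= 1.4143) by (apply Rnot_lt_le; intros A; nra).
  assert (sB' : 1.4142 <= s) by (apply Rnot_lt_le; intros A; nra).
  set (t := s - u).
  assert (ua : Rabs (u - a) <= rho).
  { apply Rabs_le. split; apply Rnot_lt_le; intros A; nra. }
  apply Rabs_le_between in ua.
  assert (t0 : 0 < t) by (unfold t; lra).
  assert (t1 : t < 2 * (s - a)) by (unfold t; lra).
  set (S := 2 - 2 * a * t).
  (* Expanding, |W|^2 <= rho^2 - a^2 + 2 a u, and rho < sqrt 2 - a. *)
  assert (m1 : u ^ 2 + v ^ 2 <= S).
  { unfold S, t. assert (rho ^ 2 <= (s - a) ^ 2) by (apply pow_incr; lra). nra. }
  assert (m0 : 0 <= u ^ 2 + v ^ 2) by nra.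
  set (w := u ^ 2 + v ^ 2) in *.
  assert (L4 : 0 <= w ^ 2 + 2 * w - 4 * u ^ 2) by (unfold w in *; lra).
  assert (L5 : 0 <= S ^ 2 + 2 * S - 4 * u ^ 2) by nra.
  replace (S ^ 2 + 2 * S - 4 * u ^ 2) with (t * (8 * s - 12 * a + 4 * (a ^ 2 - 1) * t)) in L5.
  2:{ unfold S. replace u with (s - t) by (unfold t; ring).
      replace ((s - t) ^ 2) with (s ^ 2 - 2 * s * t + t ^ 2) by ring. rewrite Hs. ring. }
  assert (L6 : 8 * s - 12 * a + 4 * (a ^ 2 - 1) * t < 0).
  { assert (0 <= a ^ 2 - 1) by nra.
    assert (4 * (a ^ 2 - 1) * t <= 8 * (a ^ 2 - 1) * (s - a)) by nra.
    assert (a < s) by lra.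
    assert ((a ^ 2 - 1) * (s - a) <= (a - 1) * (1 + s) * (s - 1)) by nra.
    nra. }
  nra.
Qed.

(** * Re-expansion of a power series at another point *)

(** The coefficient of h^j in (z + h)^k, by the recursion of Pascal's triangle
    so that no binomial coefficients have to be handled. *)
Fixpoint shift_coef (z : C) (k j : nat) : C :=
  match k with
  | O => match j with O => RtoC 1 | S _ => RtoC 0 end
  | S k' => (z * shift_coef z k' j +
             match j with O => RtoC 0 | S j' => shift_coef z k' j' end)%C
  end.

Lemma shift_coef_0 (z : C) (k : nat) : shift_coef z k 0 = (z ^ k)%C.
Proof. induction k; simpl; auto. rewrite IHk. ring. Qed.

Lemma shift_coef_1 (z : C) (k : nat) : shift_coef z (S k) 1 = (RtoC (INR (S k)) * z ^ k)%C.
Proof.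
  induction k.
  - simpl. ring.
  - change (shift_coef z (S (S k)) 1) with (z * shift_coef z (S k) 1 + shift_coef z (S k) 0)%C.
    rewrite IHk, shift_coef_0, (S_INR (S k)), RtoC_plus, !Cpow_S. ring.
Qed.

(** Truncating the binomial expansion of (z + h)^k after J terms leaves powers of
    h at least J; replacing |h| by 2 |h| buys the factor 2^(-J), uniformly in k.
    This uniformity makes the rearrangement of the double series elementary. *)
Lemma shift_coef_remainder (z h : C) (k J : nat) :
  Cmod ((z + h) ^ k - psum (shift_coef z k) h J) <= (1 / 2) ^ J * (Cmod z + 2 * Cmod h) ^ k.
Proof.
  pose proof (Cmod_ge_0 z) as Pz. pose proof (Cmod_ge_0 h) as Ph.
  revert J. induction k; intros J.
  - destruct J as [|J].
    + unfold psum. simpl. replace (1 - 0)%C with (RtoC 1) by ring. rewrite Cmod_1. lra.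
    + assert (E : psum (shift_coef z 0) h (S J) = RtoC 1).
      { unfold psum. induction J; [simpl; ring|].
        change (csum (fun k => shift_coef z 0 k * h ^ k) (S J) + 0 * h ^ S J = 1)%C.
        rewrite IHJ. ring. }
      rewrite E. replace ((z + h) ^ 0 - 1)%C with (RtoC 0) by (simpl; ring).
      rewrite Cmod_0. apply Rmult_le_pos; apply pow_le; lra.
  - destruct J as [|J].
    + unfold psum. simpl csum. replace ((z + h) ^ S k - 0)%C with ((z + h) ^ S k)%C by ring.
      rewrite Cmod_pow. simpl ((1 / 2) ^ 0). rewrite Rmult_1_l. apply pow_incr.
      split; [apply Cmod_ge_0|]. pose proof (Cmod_triangle z h). lra.
    + assert (E : psum (shift_coef z (S k)) h (S J) =
                (z * psum (shift_coef z k) h (S J) + h * psum (shift_coef z k) h J)%C).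
      { unfold psum. clear. induction J; [simpl; ring|].
        set (u := (fun j => shift_coef z (S k) j * h ^ j)%C) in *.
        set (v := (fun j => shift_coef z k j * h ^ j)%C) in *.
        change (csum u (S J) + u (S J) = z * (csum v (S J) + v (S J)) + h * (csum v J + v J))%C.
        rewrite IHJ. unfold u, v. simpl. ring. }
      rewrite E.
      replace ((z + h) ^ S k - (z * psum (shift_coef z k) h (S J) + h * psum (shift_coef z k) h J))%C
        with (z * ((z + h) ^ k - psum (shift_coef z k) h (S J)) +
              h * ((z + h) ^ k - psum (shift_coef z k) h J))%C by (simpl; ring).
      eapply Rle_trans; [apply Cmod_triangle|]. rewrite !Cmod_mult.
      pose proof (Rmult_le_compat_l _ _ _ Pz (IHk (S J))) as Q1.
      pose proof (Rmult_le_compat_l _ _ _ Ph (IHk J)) as Q2.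
      simpl in *. lra.
Qed.

Lemma shift_coef_bound (z : C) (s : R) (k j : nat) :
  0 <= s -> Cmod (shift_coef z k j) * s ^ j <= (Cmod z + s) ^ k.
Proof.
  intros Hs. pose proof (Cmod_ge_0 z) as Pz. revert j. induction k; intros j.
  - destruct j; simpl.
    + rewrite Cmod_1. lra.
    + rewrite Cmod_0. lra.
  - destruct j as [|j].
    + rewrite shift_coef_0, Cmod_pow. simpl (s ^ 0). rewrite Rmult_1_r. apply pow_incr. lra.
    + simpl. eapply Rle_trans.
      { apply Rmult_le_compat_r; [apply Rmult_le_pos; [auto|apply pow_le; auto]|].
        apply Cmod_triangle. }
      rewrite Cmod_mult. pose proof (Rmult_le_compat_l _ _ _ Pz (IHk (S j))) as Q1.
      pose proof (Rmult_le_compat_l _ _ _ Hs (IHk j)) as Q2. simpl in *. lra.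
Qed.

Lemma csum_geometric_bound (u : nat -> C) (c q : R) (n : nat) :
  0 <= q < 1 -> 0 <= c -> (forall k, Cmod (u k) <= c * q ^ k) -> Cmod (csum u n) <= c / (1 - q).
Proof.
  intros Hq Hc H.
  assert (A : Cmod (csum u n) <= c / (1 - q) * (1 - q ^ n)).
  { induction n.
    - simpl. rewrite Cmod_0. right. ring.
    - simpl csum. eapply Rle_trans; [apply Cmod_triangle|]. specialize (H n).
      replace (c / (1 - q) * (1 - q ^ S n)) with (c / (1 - q) * (1 - q ^ n) + c * q ^ n)
        by (simpl; field; lra). lra. }
  eapply Rle_trans; [exact A|]. rewrite <- (Rmult_1_r (c / (1 - q))) at 2.
  apply Rmult_le_compat_l.
  - apply Rmult_le_pos; auto. apply Rlt_le, Rinv_0_lt_compat. lra.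
  - assert (0 <= q ^ n) by (apply pow_le; lra). lra.
Qed.

Lemma ex_series_geometric_bound (u : nat -> C) (c q : R) :
  0 <= q < 1 -> (forall k, Cmod (u k) <= c * q ^ k) ->
  exists l, is_cseries u l.
Proof.
  intros Hq H.
  apply (ex_series_le (K := C_AbsRing) (V := C_CompleteNormedModule) u (fun k => c * q ^ k)).
  - intros k. eapply Rle_trans; [|apply H]. right. reflexivity.
  - apply (ex_series_scal (V := R_NormedModule) c (fun k => q ^ k)). apply ex_series_geom.
    rewrite Rabs_pos_eq; lra.
Qed.

Lemma is_series_finite_swap (a : nat -> C) (T : nat -> nat -> C) (A : nat -> C) (h : C) (J : nat) :
  (forall j, is_cseries (fun k => a k * T k j)%C (A j)) ->
  is_cseries
    (fun k => a k * psum (T k) h J)%C (psum A h J).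
Proof.
  intros H. induction J.
  - apply is_series_csum. intros e He. exists 0%nat. intros n _. unfold psum. simpl.
    assert (E : csum (fun k => a k * 0)%C n = RtoC 0).
    { induction n; simpl; auto. rewrite IHn. ring. }
    rewrite E, Cmod_sub_self. auto.
  - pose proof (is_series_plus (K := C_AbsRing) (V := C_NormedModule) _ _ _ _ IHJ
      (is_series_scal (K := C_AbsRing) (V := C_NormedModule) (h ^ J)%C _ _ (H J))) as Q.
    replace (psum A h (S J)) with
      (plus (G := C_NormedModule) (psum A h J) (scal (V := C_NormedModule) (h ^ J)%C (A J))).
    + eapply is_series_ext; [|exact Q]. intros k. unfold psum.
      change (a k * csum (fun j => T k j * h ^ j) J + h ^ J * (a k * T k J) =
              a k * (csum (fun j => T k j * h ^ j) J + T k J * h ^ J))%C. ring.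
    + change (psum A h J + h ^ J * A J = psum A h J + A J * h ^ J)%C. ring.
Qed.

(** For fixed J the finite sum over powers of h can be exchanged with the series
    over k, and the remainder is at most 2^(-J) times the sum of
    |a_k| (|z0| + 2 |h|)^k, which converges for small h. *)
Lemma pseries_reexpansion (f : C -> C) (a : nat -> C) (z0 : C) :
  (forall z, disk 1 z -> is_cpseries a z (f z)) ->
  disk 1 z0 ->
  exists (A : nat -> C) (eps : posreal),
    (forall j, is_cseries
       (fun k => a k * shift_coef z0 k j)%C (A j)) /\
    forall z, Cmod (z - z0) < eps ->
      is_cpseries A (z - z0)%C (f z).
Proof.
  intros Hf Hz0. unfold disk in Hz0. pose proof (Cmod_ge_0 z0) as P0.
  set (r := (1 + Cmod z0) / 2). assert (Hr : Cmod z0 < r < 1) by (unfold r; lra).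
  assert (Mr : Cmod (RtoC r) = r) by (rewrite Cmod_R, Rabs_pos_eq; lra).
  destruct (is_pseries_bounded a (RtoC r) (f (RtoC r))) as (M & HM & B).
  { apply Hf. unfold disk. rewrite Mr. lra. }
  rewrite Mr in B.
  (* Then |z0| + 2 s < r, which leaves room for the doubling of |h| in
     [shift_coef_remainder]. *)
  set (s := (r - Cmod z0) / 4). assert (Hs : 0 < s) by (unfold s; lra).
  set (X := Cmod z0 + 2 * s). assert (HX : 0 < X < r) by (unfold X, s in *; lra).
  assert (Hq : 0 <= X / r < 1).
  { split; [apply Rlt_le, Rdiv_lt_0_compat; lra|].
    apply Rmult_lt_reg_r with r; [lra|]. unfold Rdiv. rewrite Rmult_assoc, Rinv_l; lra. }
  assert (Ba : forall k, Cmod (a k) * X ^ k <= M * (X / r) ^ k).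
  { intros k. replace (X ^ k) with (r ^ k * (X / r) ^ k).
    - rewrite <- Rmult_assoc. apply Rmult_le_compat_r; [apply pow_le; lra|auto].
    - rewrite <- Rpow_mult_distr. f_equal. field. lra. }
  assert (Ex : forall j, exists l, is_cseries
       (fun k => a k * shift_coef z0 k j)%C l).
  { intros j. apply (ex_series_geometric_bound _ (M / s ^ j) (X / r)); auto.
    intros k. assert (Psj : 0 < s ^ j) by (apply pow_lt; auto).
    apply Rmult_le_reg_r with (s ^ j); auto.
    replace (M / s ^ j * (X / r) ^ k * s ^ j) with (M * (X / r) ^ k) by (field; lra).
    eapply Rle_trans; [|apply Ba]. rewrite Cmod_mult, Rmult_assoc.
    apply Rmult_le_compat_l; [apply Cmod_ge_0|].
    eapply Rle_trans; [apply shift_coef_bound; lra|]. apply pow_incr. unfold X. lra. }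
  pose (A := fun j => proj1_sig (constructive_indefinite_description _ (Ex j))).
  assert (HA : forall j, is_cseries
       (fun k => a k * shift_coef z0 k j)%C (A j)).
  { intros j. exact (proj2_sig (constructive_indefinite_description _ (Ex j))). }
  clearbody A. exists A, (mkposreal s Hs). split; auto. simpl.
  intros z Hz. set (h := (z - z0)%C) in *.
  assert (Hzd : disk 1 z).
  { unfold disk. pose proof (Cmod_triangle_sub z z0). fold h in H. unfold s in *. lra. }
  assert (PC : 0 < M / (1 - X / r)) by (apply Rdiv_lt_0_compat; lra).
  assert (Rem : forall J, Cmod (psum A h J - f z) <= (1 / 2) ^ J * (M / (1 - X / r))).
  { intros J. apply le_epsilon. intros e He.
    pose proof (is_series_finite_swap a (shift_coef z0) A h J HA) as S1.
    pose proof (proj1 (is_pseries_is_series a z (f z)) (Hf z Hzd)) as S2.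
    rewrite is_series_csum in S1, S2.
    destruct (S1 (e / 2)) as (N1 & Q1); [lra|]. destruct (S2 (e / 2)) as (N2 & Q2); [lra|].
    specialize (Q1 (N1 + N2)%nat ltac:(lia)). specialize (Q2 (N1 + N2)%nat ltac:(lia)).
    set (n := (N1 + N2)%nat) in *.
    assert (D : Cmod (csum (fun k => a k * z ^ k)%C n - csum (fun k => a k * psum (shift_coef z0 k) h J)%C n)
       <= (1 / 2) ^ J * (M / (1 - X / r))).
    { replace (csum (fun k => a k * z ^ k)%C n - csum (fun k => a k * psum (shift_coef z0 k) h J)%C n)%C
        with (csum (fun k => a k * ((z0 + h) ^ k - psum (shift_coef z0 k) h J))%C n).
      - replace ((1 / 2) ^ J * (M / (1 - X / r))) with ((1 / 2) ^ J * M / (1 - X / r)) by (field; lra).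
        assert (P2 : 0 <= (1 / 2) ^ J) by (apply pow_le; lra).
        apply csum_geometric_bound; auto.
        + apply Rmult_le_pos; lra.
        + intros k. rewrite Cmod_mult.
          apply Rle_trans with (Cmod (a k) * ((1 / 2) ^ J * X ^ k)).
          * apply Rmult_le_compat_l; [apply Cmod_ge_0|].
            eapply Rle_trans; [apply shift_coef_remainder|].
            apply Rmult_le_compat_l; auto. apply pow_incr. pose proof (Cmod_ge_0 h).
            unfold X. lra.
          * replace (Cmod (a k) * ((1 / 2) ^ J * X ^ k)) with ((1 / 2) ^ J * (Cmod (a k) * X ^ k)) by ring.
            rewrite Rmult_assoc. apply Rmult_le_compat_l; auto.
      - replace (z0 + h)%C with z by (unfold h; ring). clear.
        induction n; simpl; [ring|]. rewrite IHn. ring. }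
    match type of D with Cmod (?p - ?q) <= _ => set (u := p) in *; set (v := q) in * end.
    replace (psum A h J - f z)%C with ((u - f z) + - (u - v) + - (v - psum A h J))%C by ring.
    eapply Rle_trans; [apply Cmod_triangle|].
    eapply Rle_trans; [apply Rplus_le_compat_r, Cmod_triangle|]. rewrite !Cmod_opp. lra. }
  apply is_pseries_psum. intros e He.
  destruct (pow_lt_1_zero (1 / 2) ltac:(rewrite Rabs_pos_eq; lra) (e / (M / (1 - X / r)))) as (N & HN).
  { apply Rdiv_lt_0_compat; auto. }
  exists N. intros n Hn. specialize (HN n ltac:(lia)). rewrite Rabs_pos_eq in HN by (apply pow_le; lra).
  eapply Rle_lt_trans; [apply Rem|].
  apply Rlt_le_trans with (e / (M / (1 - X / r)) * (M / (1 - X / r))).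
  - apply Rmult_lt_compat_r; auto.
  - right. field. lra.
Qed.

Lemma pseries_analytic (f : C -> C) (a : nat -> C) :
  (forall z, disk 1 z -> is_cpseries a z (f z)) ->
  analytic_on (disk 1) f.
Proof.
  intros Hf z0 Hz0. destruct (pseries_reexpansion f a z0 Hf Hz0) as (A & eps & _ & H).
  exists A, eps. exact H.
Qed.

Lemma pseries_center_is_Cderive (f : C -> C) (a : nat -> C) (z0 : C) (eps : R) :
  0 < eps ->
  (forall z, Cmod (z - z0) < eps ->
     is_cpseries a (z - z0)%C (f z)) ->
  is_Cderive f z0 (a 1%nat).
Proof.
  intros He H.
  assert (F0 : f z0 = a 0%nat).
  { pose proof (H z0) as H0. rewrite Cmod_sub_self in H0. specialize (H0 He).
    replace (z0 - z0)%C with (RtoC 0) in H0 by ring.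
    apply (is_pseries_uniq a (RtoC 0)); auto. apply is_pseries_center. }
  pose (K := fun z => if Ceq_dec z z0 then a 1%nat else ((f z - f z0) / (z - z0))%C).
  exists K. split; [|split].
  - apply locally_lipschitz_Ccontinuous, pseries_lipschitz with (fun k => a (S k)) eps; auto.
    intros z Hz. unfold K. destruct (Ceq_dec z z0) as [->|N].
    + replace (z0 - z0)%C with (RtoC 0) by ring. apply (is_pseries_center (fun k => a (S k))).
    + rewrite F0. apply is_pseries_shift; auto. intros A. apply N, Ceq_minus; auto.
  - unfold K. destruct (Ceq_dec z0 z0); congruence.
  - intros z. unfold K. destruct (Ceq_dec z z0) as [->|N]; [ring|].
    field. intros A. apply N, Ceq_minus; auto.
Qed.

(** The derivative is the linear coefficient of the series re-expanded at [z0]. *)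
Lemma pseries_is_Cderive (f : C -> C) (a : nat -> C) (z0 : C) :
  (forall z, disk 1 z -> is_cpseries a z (f z)) ->
  disk 1 z0 ->
  exists d, is_Cderive f z0 d /\
    is_cpseries
      (fun k => RtoC (INR (S k)) * a (S k))%C z0 d.
Proof.
  intros Hf Hz0. destruct (pseries_reexpansion f a z0 Hf Hz0) as (A & eps & HA & H).
  exists (A 1%nat). split; [apply (pseries_center_is_Cderive f A z0 eps); auto; apply cond_pos|].
  specialize (HA 1%nat). rewrite is_series_csum in HA. rewrite is_pseries_psum.
  intros e He. destruct (HA e He) as (N & HN). exists N. intros n Hn.
  specialize (HN (S n) ltac:(lia)).
  replace (psum (fun k => INR (S k) * a (S k))%C z0 n)
    with (csum (fun k => a k * shift_coef z0 k 1)%C (S n)); auto.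
  clear. unfold psum. induction n.
  - simpl. ring.
  - change (csum (fun k => a k * shift_coef z0 k 1) (S n) + a (S n) * shift_coef z0 (S n) 1 =
      csum (fun k => INR (S k) * a (S k) * z0 ^ k) n + INR (S n) * a (S n) * z0 ^ n)%C.
    rewrite IHn, shift_coef_1. ring.
Qed.

(** * Binomial series *)

(** The coefficients of (1 - w)^(-b). *)
Fixpoint binom_coef (b : R) (k : nat) : R :=
  match k with
  | O => 1
  | S j => binom_coef b j * ((b + INR j) / INR (S j))
  end.

Lemma binom_coef_derive (b : R) (k : nat) :
  INR (S k) * binom_coef b (S k) = b * binom_coef (b + 1) k.
Proof.
  induction k.
  - simpl. field.
  - assert (P1 : INR (S k) <> 0) by (apply not_0_INR; lia).
    assert (P2 : INR (S (S k)) <> 0) by (apply not_0_INR; lia).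
    change (binom_coef b (S (S k)))
      with (binom_coef b (S k) * ((b + INR (S k)) / INR (S (S k)))).
    change (binom_coef (b + 1) (S k)) with (binom_coef (b + 1) k * ((b + 1 + INR k) / INR (S k))).
    replace (INR (S (S k)) * (binom_coef b (S k) * ((b + INR (S k)) / INR (S (S k)))))
      with (INR (S k) * binom_coef b (S k) * ((b + INR (S k)) / INR (S k))).
    2:{ set (u := INR (S k)) in *. set (v := INR (S (S k))) in *.
        set (c := binom_coef b (S k)). clearbody u v c. field. auto. }
    rewrite IHk. replace (INR (S k)) with (INR k + 1) in * by (symmetry; apply S_INR).
    field. auto.
Qed.

Lemma binom_coef_sub (b : R) (k : nat) :
  binom_coef (b + 1) (S k) - binom_coef (b + 1) k = binom_coef b (S k).
Proof.
  assert (P1 : INR (S k) <> 0) by (apply not_0_INR; lia).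
  apply Rmult_eq_reg_l with (INR (S k)); auto. rewrite binom_coef_derive.
  change (binom_coef (b + 1) (S k)) with (binom_coef (b + 1) k * ((b + 1 + INR k) / INR (S k))).
  replace (INR (S k)) with (INR k + 1) in * by (symmetry; apply S_INR). field. auto.
Qed.

Lemma binom_coef_pos (b : R) (k : nat) : 0 < b -> 0 < binom_coef b k.
Proof.
  intros Hb. induction k; [simpl; lra|].
  change (0 < binom_coef b k * ((b + INR k) / INR (S k))).
  apply Rmult_lt_0_compat; auto. apply Rdiv_lt_0_compat.
  - pose proof (pos_INR k). lra.
  - apply lt_0_INR. lia.
Qed.

(** The ratio test needs nonzero terms, but the coefficients vanish eventually
    when b is a nonpositive integer; the majorant has positive ones. *)
Lemma binom_coef_majorant (b : R) (k : nat) :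
  Rabs (binom_coef b k) <= binom_coef (Rabs b + 1) k.
Proof.
  induction k.
  - simpl. rewrite Rabs_R1. lra.
  - change (Rabs (binom_coef b k * ((b + INR k) / INR (S k))) <=
      binom_coef (Rabs b + 1) k * ((Rabs b + 1 + INR k) / INR (S k))).
    rewrite Rabs_mult. apply Rmult_le_compat; try apply Rabs_pos; auto.
    assert (P : 0 < INR (S k)) by (apply lt_0_INR; lia). pose proof (pos_INR k).
    unfold Rdiv. rewrite Rabs_mult, (Rabs_pos_eq (/ INR (S k))).
    + apply Rmult_le_compat_r; [apply Rlt_le, Rinv_0_lt_compat; auto|].
      eapply Rle_trans; [apply Rabs_triang|]. rewrite (Rabs_pos_eq (INR k)); lra.
    + apply Rlt_le, Rinv_0_lt_compat; auto.
Qed.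

Lemma binom_series_converges (b : R) (w : C) :
  disk 1 w -> exists l, is_cpseries
    (fun k => RtoC (binom_coef b k)) w l.
Proof.
  intros Hw. unfold disk in Hw. pose proof (Cmod_ge_0 w) as Pw.
  set (t := (1 + Cmod w) / 2). assert (Ht : 0 < t < 1) by (unfold t; lra).
  set (B := Rabs b + 1). assert (HB : 0 < B) by (pose proof (Rabs_pos b); unfold B; lra).
  assert (Pt : forall k, 0 < t ^ k) by (intros; apply pow_lt; lra).
  assert (S : ex_series (fun k => Rabs (binom_coef B k * t ^ k))).
  { apply (ex_series_DAlembert _ t); [lra| |].
    - intros k. pose proof (binom_coef_pos B k HB). specialize (Pt k).
      apply Rgt_not_eq, Rmult_lt_0_compat; auto.
    - apply is_lim_seq_ext with (fun k => t * (1 + (B - 1) * / INR (S k))).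
      + intros k. assert (Pk : 0 < INR (S k)) by (apply lt_0_INR; lia).
        pose proof (binom_coef_pos B k HB). specialize (Pt k).
        replace (binom_coef B (S k) * t ^ S k / (binom_coef B k * t ^ k))
          with (t * ((B + INR k) / INR (S k))).
        * rewrite Rabs_pos_eq.
          -- rewrite S_INR in *. field. lra.
          -- apply Rmult_le_pos; [lra|]. apply Rlt_le, Rdiv_lt_0_compat; auto.
             pose proof (pos_INR k). lra.
        * change (binom_coef B (S k)) with (binom_coef B k * ((B + INR k) / INR (S k))).
          rewrite <- tech_pow_Rmult. field. repeat split; lra.
      + replace (Finite t) with (Rbar_mult t (Finite (1 + (B - 1) * 0))).
        2:{ simpl. f_equal. ring. }
        apply is_lim_seq_scal_l.
        apply (is_lim_seq_plus' (fun _ => 1) (fun k => (B - 1) * / INR (S k)));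
          [apply is_lim_seq_const|].
        apply (is_lim_seq_scal_l (fun k => / INR (S k)) (B - 1) 0).
        replace (Finite 0) with (Rbar_inv p_infty) by reflexivity.
        apply is_lim_seq_inv; [|discriminate].
        apply (is_lim_seq_incr_1 INR). apply is_lim_seq_INR. }
  destruct (ex_series_le (K := C_AbsRing) (V := C_CompleteNormedModule)
    (fun k => binom_coef b k * w ^ k)%C (fun k => Rabs (binom_coef B k * t ^ k))) as (l & Hl); auto.
  - intros k. change (Cmod (binom_coef b k * w ^ k) <= Rabs (binom_coef B k * t ^ k)).
    rewrite Cmod_mult, Cmod_R, Cmod_pow, Rabs_mult, (Rabs_pos_eq (t ^ k)) by (apply Rlt_le; auto).
    apply Rmult_le_compat; try apply Rabs_pos; [apply pow_le; auto| |].
    + eapply Rle_trans; [apply binom_coef_majorant|]. apply Rle_abs.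
    + apply pow_incr. unfold t. lra.
  - exists l. apply is_pseries_is_series. exact Hl.
Qed.

(** The function (1 - w)^(-b) on the unit disk. *)
Definition binom_fun (b : R) (w : C) : C :=
  epsilon (inhabits (RtoC 0)) (fun l =>
    is_cpseries (fun k => RtoC (binom_coef b k)) w l).

Lemma binom_fun_series (b : R) (w : C) : disk 1 w ->
  is_cpseries (fun k => RtoC (binom_coef b k)) w (binom_fun b w).
Proof.
  intros Hw. unfold binom_fun. apply epsilon_spec. apply binom_series_converges; auto.
Qed.

Lemma binom_fun_0 (b : R) : binom_fun b (RtoC 0) = RtoC 1.
Proof.
  apply (is_pseries_uniq (fun k => RtoC (binom_coef b k)) (RtoC 0)).
  - apply binom_fun_series, disk0.
  - apply (is_pseries_center (fun k => RtoC (binom_coef b k))).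
Qed.

Lemma binom_fun_is_Cderive (b : R) (w : C) : disk 1 w ->
  is_Cderive (binom_fun b) w (RtoC b * binom_fun (b + 1) w)%C.
Proof.
  intros Hw.
  destruct (pseries_is_Cderive (binom_fun b) _ w (binom_fun_series b) Hw) as (d & Hd & Sd).
  replace (RtoC b * binom_fun (b + 1) w)%C with d; auto.
  apply (is_pseries_uniq _ w _ _ Sd).
  pose proof (is_pseries_scal (K := C_AbsRing) (V := C_NormedModule) (RtoC b) _ w _
    (Cmult_comm w (RtoC b)) (binom_fun_series (b + 1) w Hw)) as Q.
  eapply is_pseries_ext; [|exact Q]. intros k.
  change (RtoC b * RtoC (binom_coef (b + 1) k) = RtoC (INR (S k)) * RtoC (binom_coef b (S k)))%C.
  rewrite <- !RtoC_mult, binom_coef_derive. reflexivity.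
Qed.

Lemma binom_fun_succ (b : R) (w : C) : disk 1 w ->
  ((1 - w) * binom_fun (b + 1) w = binom_fun b w)%C.
Proof.
  intros Hw. apply (is_pseries_uniq (fun k => RtoC (binom_coef b k)) w);
    [|apply binom_fun_series; auto].
  pose proof (binom_fun_series (b + 1) w Hw) as Sb.
  pose proof (is_pseries_minus (K := C_AbsRing) (V := C_NormedModule) _ _ w _ _ Sb
    (is_pseries_incr_1 (K := C_AbsRing) (V := C_NormedModule) _ w _ Sb)) as Q.
  replace ((1 - w) * binom_fun (b + 1) w)%C with
    (binom_fun (b + 1) w + - (w * binom_fun (b + 1) w))%C by ring.
  eapply is_pseries_ext; [|exact Q]. intros [|k].
  - change (RtoC 1 + - RtoC 0 = RtoC 1)%C. ring.
  - change (RtoC (binom_coef (b + 1) (S k)) + - RtoC (binom_coef (b + 1) k) = RtoC (binom_coef b (S k)))%C.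
    rewrite <- (binom_coef_sub b k), RtoC_minus. ring.
Qed.

(** Restrict the real and imaginary parts to the segment from 0 to [w]. *)
Lemma is_Cderive_zero_constant (g : C -> C) :
  (forall z, disk 1 z -> is_Cderive g z (RtoC 0)) -> forall w, disk 1 w -> g w = g (RtoC 0).
Proof.
  intros H w Hw.
  assert (D : forall (pr : C -> R), (forall u v, pr (u - v)%C = pr u - pr v) ->
     (forall u, Rabs (pr u) <= Cmod u) -> pr (g (RtoC 0)) = pr (g w)).
  { intros pr Hl Hb.
    pose (F := fun t : R => pr (g (RtoC t * w)%C)).
    assert (E : F 0 = F 1).
    { apply (eq_is_derive (V := R_NormedModule) F 0 1); [|lra].
      intros t Ht.
      assert (Dt : disk 1 (RtoC t * w)%C).
      { unfold disk in *. rewrite Cmod_mult, Cmod_R, Rabs_pos_eq by lra.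
        pose proof (Cmod_ge_0 w). nra. }
      apply is_derive_Reals. destruct (H _ Dt) as (K & CK & K0 & EK).
      intros e He. destruct (CK e He) as (d & Hd & HK).
      exists (mkposreal d Hd). intros h Nh Hh. simpl in Hh. change (zero : R) with 0.
      assert (Eh : (RtoC (t + h) * w - RtoC t * w = RtoC h * w)%C) by (rewrite RtoC_plus; ring).
      assert (Hhw : Cmod (RtoC h * w) <= Rabs h).
      { rewrite Cmod_mult, Cmod_R. rewrite <- (Rmult_1_r (Rabs h)) at 2.
        apply Rmult_le_compat_l; [apply Rabs_pos|]. unfold disk in Hw. lra. }
      specialize (HK (RtoC (t + h) * w)%C). rewrite Eh, K0 in HK. specialize (HK ltac:(lra)).
      replace (K (RtoC (t + h) * w)%C - 0)%C with (K (RtoC (t + h) * w)%C) in HK by ring.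
      assert (PH : 0 < Rabs h) by (apply Rabs_pos_lt; auto).
      unfold F. rewrite <- Hl, EK, Eh, Rminus_0_r. unfold Rdiv. rewrite Rabs_mult, Rabs_inv.
      apply Rmult_lt_reg_r with (Rabs h); auto. rewrite Rmult_assoc, Rinv_l, Rmult_1_r by lra.
      eapply Rle_lt_trans; [apply Hb|]. rewrite Cmod_mult.
      apply Rle_lt_trans with (Rabs h * Cmod (K (RtoC (t + h) * w)%C)).
      - apply Rmult_le_compat_r; auto. apply Cmod_ge_0.
      - rewrite Rmult_comm. apply Rmult_lt_compat_r; auto. }
    unfold F in E. replace (RtoC 0 * w)%C with (RtoC 0) in E by ring.
    replace (RtoC 1 * w)%C with w in E by ring. exact E. }
  apply injective_projections; symmetry.
  - apply (D fst).
    + intros u v. simpl. ring.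
    + intros u. exact (re_le_Cmod u).
  - apply (D snd).
    + intros u v. simpl. ring.
    + intros u. eapply Rle_trans; [apply Rmax_r|apply Rmax_Cmod].
Qed.

Lemma disk1_sub_neq0 (w : C) : disk 1 w -> (1 - w)%C <> RtoC 0.
Proof.
  intros Hw A. unfold disk in Hw. replace w with (RtoC 1) in Hw by (apply Ceq_minus; exact A).
  rewrite Cmod_1 in Hw. lra.
Qed.

(** The product of the functions for b and -b has derivative zero, hence is
    constantly 1. *)
Lemma binom_fun_neq0 (b : R) (w : C) : disk 1 w -> binom_fun b w <> RtoC 0.
Proof.
  intros Hw A.
  assert (E : (binom_fun b w * binom_fun (- b) w = 1)%C).
  { rewrite (is_Cderive_zero_constant (fun w => binom_fun b w * binom_fun (- b) w)%C); auto.
    - rewrite !binom_fun_0. ring.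
    - intros z Hz. pose proof (is_Cderive_mult _ _ z _ _ (binom_fun_is_Cderive b z Hz) (binom_fun_is_Cderive (- b) z Hz)) as Q.
      replace (RtoC 0) with
        (b * binom_fun (b + 1) z * binom_fun (- b) z + binom_fun b z * ((- b)%R * binom_fun (- b + 1) z))%C; auto.
      rewrite <- (binom_fun_succ b z Hz), <- (binom_fun_succ (- b) z Hz), RtoC_opp. ring. }
  rewrite A, Cmult_0_l in E. apply RtoC_inj in E. lra.
Qed.

(** * Series in z^n *)

(** The coefficients in z of a series in z^n. *)
Definition lacunary (n : nat) (a : nat -> C) (m : nat) : C :=
  if Nat.eqb (m mod n) 0 then a (m / n)%nat else RtoC 0.

Lemma lacunary_0 (n : nat) (a : nat -> C) : (1 <= n)%nat -> lacunary n a 0 = a 0%nat.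
Proof.
  intros Hn. unfold lacunary. rewrite Nat.Div0.mod_0_l, Nat.Div0.div_0_l. reflexivity.
Qed.

Lemma lacunary_gap (n : nat) (a : nat -> C) (q r : nat) :
  (1 <= r < n)%nat -> lacunary n a (n * q + r) = RtoC 0.
Proof.
  intros Hr. unfold lacunary.
  replace ((n * q + r) mod n)%nat with r.
  - destruct r; [lia|reflexivity].
  - rewrite Nat.add_comm, Nat.mul_comm, Nat.Div0.mod_add, Nat.mod_small; lia.
Qed.

Lemma lacunary_mul (n : nat) (a : nat -> C) (q : nat) :
  (1 <= n)%nat -> lacunary n a (n * q) = a q.
Proof.
  intros Hn. unfold lacunary. rewrite Nat.mul_comm, Nat.Div0.mod_mul, Nat.div_mul by lia.
  reflexivity.
Qed.

(** Between two consecutive multiples of [n] the partial sums do not change. *)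
Lemma psum_lacunary (n : nat) (a : nat -> C) (z : C) (q r : nat) :
  (1 <= n)%nat -> (r < n)%nat ->
  psum (lacunary n a) z (S (n * q + r)) = psum a (z ^ n)%C (S q).
Proof.
  intros Hn. revert r.
  assert (Step : forall q, psum (lacunary n a) z (n * q) = psum a (z ^ n)%C q ->
    forall r, (r < n)%nat -> psum (lacunary n a) z (S (n * q + r)) = psum a (z ^ n)%C (S q)).
  { intros q' H. induction r; intros Hr.
    - rewrite Nat.add_0_r.
      change (psum (lacunary n a) z (n * q') + lacunary n a (n * q') * z ^ (n * q') =
              psum a (z ^ n) q' + a q' * (z ^ n) ^ q')%C.
      rewrite H, lacunary_mul, Cpow_mult_r by auto. reflexivity.
    - change (psum (lacunary n a) z (n * q' + S r) + lacunary n a (n * q' + S r) * z ^ (n * q' + S r) =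
              psum a (z ^ n) (S q'))%C.
      rewrite lacunary_gap by lia. rewrite <- IHr by lia.
      replace (n * q' + S r)%nat with (S (n * q' + r)) by lia. ring. }
  apply Step. induction q.
  - rewrite Nat.mul_0_r. reflexivity.
  - specialize (Step q IHq (n - 1)%nat ltac:(lia)).
    replace (S (n * q + (n - 1))) with (n * S q)%nat in Step by nia. exact Step.
Qed.

Lemma is_pseries_lacunary (n : nat) (a : nat -> C) (z l : C) :
  (1 <= n)%nat ->
  is_cpseries a (z ^ n)%C l ->
  is_cpseries (lacunary n a) z l.
Proof.
  intros Hn. rewrite !is_pseries_psum. intros H e He. destruct (H e He) as (N & HN).
  exists (S (n * N)). intros [|m] Hm; [lia|].
  rewrite (Nat.div_mod_eq m n), psum_lacunary; auto.
  - apply HN. assert (N <= m / n)%nat; [|lia].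
    apply Nat.div_le_lower_bound; lia.
  - apply Nat.mod_upper_bound. lia.
Qed.

Lemma disk_pow (z : C) (n : nat) : (1 <= n)%nat -> disk 1 z -> disk 1 (z ^ n)%C.
Proof.
  intros Hn Hz. unfold disk. rewrite Cmod_pow. apply disk_pow_lt1; auto.
Qed.

Lemma class_A_of_pow_series (n : nat) (F : C -> C) (a : nat -> C) :
  (1 <= n)%nat -> a 0%nat = RtoC 1 ->
  (forall w, disk 1 w -> is_cpseries a w (F w)) ->
  class_A n (fun z => z * F (z ^ n))%C.
Proof.
  intros Hn a0 HF.
  assert (Sr : forall z, disk 1 z -> is_cpseries
     (PS_incr_1 (V := C_NormedModule) (lacunary n a)) z (z * F (z ^ n))%C).
  { intros z Hz. apply (is_pseries_incr_1 (K := C_AbsRing) (V := C_NormedModule)).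
    apply is_pseries_lacunary; auto. apply HF, disk_pow; auto. }
  split; [apply (pseries_analytic _ _ Sr)|].
  exists (PS_incr_1 (V := C_NormedModule) (lacunary n a)). split; [reflexivity|].
  split; [|split; [|exact Sr]].
  - change (lacunary n a 0 = RtoC 1). rewrite lacunary_0; auto.
  - intros [|k] Hk; [lia|]. change (lacunary n a k = RtoC 0).
    replace k with (n * 0 + k)%nat by lia. apply lacunary_gap. lia.
Qed.

(** The coefficients of (1 + c w)/(1 - w). *)
Definition moebius_coef (c : R) (k : nat) : C :=
  match k with O => RtoC 1 | S _ => RtoC (1 + c) end.

Lemma moebius_series (c : R) (w : C) : disk 1 w ->
  is_cpseries (moebius_coef c) w ((1 + c * w) / (1 - w))%C.
Proof.
  intros Hw. apply is_pseries_psum. intros e He.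
  pose proof (disk1_sub_neq0 w Hw) as N1.
  assert (P1 : 0 < Cmod (1 - w)) by (apply Cmod_gt_0; auto).
  unfold disk in Hw. pose proof (Cmod_ge_0 w) as Pw.
  set (k := Rabs (1 + c) / Cmod (1 - w)).
  assert (Pk : 0 <= k) by (apply Rmult_le_pos; [apply Rabs_pos|apply Rlt_le, Rinv_0_lt_compat; auto]).
  destruct (pow_lt_1_zero (Cmod w) ltac:(rewrite Rabs_pos_eq; lra) (e / (k + 1))) as (N & HN).
  { apply Rdiv_lt_0_compat; lra. }
  exists (S N). intros [|n] Hn; [lia|].
  assert (E : (psum (moebius_coef c) w (S n) - (1 + c * w) / (1 - w) =
              - (RtoC (1 + c) * w ^ S n / (1 - w)))%C).
  { clear - N1. rewrite RtoC_plus. unfold psum. induction n.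
    - simpl. field. auto.
    - change (csum (fun k => moebius_coef c k * w ^ k) (S n) + RtoC (1 + c) * w ^ S n
               - (1 + c * w) / (1 - w) = - ((1 + c) * w ^ S (S n) / (1 - w)))%C.
      transitivity (csum (fun k => moebius_coef c k * w ^ k)%C (S n) - (1 + c * w) / (1 - w)
         + (1 + c) * w ^ S n)%C; [rewrite RtoC_plus; ring|].
      rewrite IHn. rewrite (Cpow_S w (S n)). field. auto. }
  rewrite E, Cmod_opp, Cmod_div, Cmod_mult, Cmod_R, Cmod_pow by auto.
  replace (Rabs (1 + c) * Cmod w ^ S n / Cmod (1 - w)) with (k * Cmod w ^ S n)
    by (unfold k; field; lra).
  specialize (HN (S n) ltac:(lia)). rewrite Rabs_pos_eq in HN by (apply pow_le; auto).
  apply Rle_lt_trans with (k * (e / (k + 1))).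
  - apply Rmult_le_compat_l; lra.
  - apply Rmult_lt_reg_r with (k + 1); [lra|].
    replace (k * (e / (k + 1)) * (k + 1)) with (k * e) by (field; lra). nra.
Qed.

Lemma moebius_pow_series (n : nat) (c : R) (Q : C -> C) :
  (1 <= n)%nat ->
  (forall z, disk 1 z -> Q z = ((1 + c * z ^ n) / (1 - z ^ n))%C) ->
  forall z, disk 1 z ->
    is_cpseries (lacunary n (moebius_coef c)) z (Q z).
Proof.
  intros Hn EQ z Hz. rewrite EQ by auto. apply is_pseries_lacunary; auto.
  apply moebius_series, disk_pow; auto.
Qed.

Lemma moebius_Re_pos (w : C) : disk 1 w -> 0 < Re ((1 + w) / (1 - w))%C.
Proof.
  intros Hw. pose proof (disk1_sub_neq0 w Hw) as N1.
  assert (P1 : 0 < Cmod (1 - w)) by (apply Cmod_gt_0; auto).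
  set (p := ((1 + w) / (1 - w))%C).
  pose proof (Cmod_plus1_minus1 p) as H.
  assert (E : (p + - (1) = w * (p + 1))%C) by (unfold p; field; auto).
  assert (P2 : 0 < Cmod (p + 1)).
  { replace (p + 1)%C with (2 / (1 - w))%C by (unfold p; field; auto).
    rewrite Cmod_div, Cmod_R, Rabs_pos_eq by (auto; lra). apply Rdiv_lt_0_compat; lra. }
  rewrite E, Cmod_mult in H. unfold disk in Hw. pose proof (Cmod_ge_0 w).
  assert (Cmod w * Cmod (p + 1) < Cmod (p + 1)) by nra.
  assert (0 <= Cmod w * Cmod (p + 1)) by (apply Rmult_le_pos; lra).
  nra.
Qed.

(** * Extremal functions *)

(** Here b = 2 (1 - alpha)/n makes z g'/g equal to the extremal Möbius function
    of z^n. *)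
Definition extremal_starlike (n : nat) (b : R) (z : C) : C := (z * binom_fun b (z ^ n))%C.
(** The product of [extremal_starlike n b] and (1 + z^n)/(1 - z^n), with the
    denominator absorbed in the exponent b + 1. *)
Definition extremal_close (n : nat) (b : R) (z : C) : C :=
  (z * ((1 + z ^ n) * binom_fun (b + 1) (z ^ n)))%C.

Lemma pow_pred_mult (z : C) (n : nat) : (1 <= n)%nat -> (z * z ^ pred n = z ^ n)%C.
Proof. intros Hn. destruct n; [lia|]. reflexivity. Qed.

Lemma binom_pow_is_Cderive (n : nat) (b : R) (z : C) :
  (1 <= n)%nat -> disk 1 z ->
  is_Cderive (fun z => binom_fun b (z ^ n))%C z
    (b * binom_fun (b + 1) (z ^ n) * (INR n * z ^ pred n))%C.
Proof.
  intros Hn Hz. apply (is_Cderive_comp (binom_fun b) (fun z => z ^ n)%C).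
  - apply is_Cderive_pow.
  - apply binom_fun_is_Cderive, disk_pow; auto.
Qed.

Lemma extremal_starlike_zlogder (n : nat) (alpha : R) (z : C) :
  (1 <= n)%nat -> disk 1 z ->
  zlogder (extremal_starlike n (2 * (1 - alpha) / INR n)) z =
    ((1 + RtoC (1 - 2 * alpha) * z ^ n) / (1 - z ^ n))%C.
Proof.
  intros Hn Hz.
  pose proof (disk_pow z n Hn Hz) as Hw. pose proof (disk1_sub_neq0 _ Hw) as N1.
  destruct (Ceq_dec z 0) as [->|Nz].
  { unfold zlogder, fill1. destruct (Ceq_dec 0 0); [|congruence].
    destruct n; [lia|]. simpl. field. }
  set (b := 2 * (1 - alpha) / INR n).
  rewrite (zlogder_neq0 _ z (1 * binom_fun b (z ^ n)
    + z * (b * binom_fun (b + 1) (z ^ n) * (INR n * z ^ pred n)))%C); auto.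
  2:{ apply (is_Cderive_mult (fun z => z) (fun z => binom_fun b (z ^ n))%C); [apply is_Cderive_id|].
      apply binom_pow_is_Cderive; auto. }
  unfold extremal_starlike. pose proof (binom_fun_neq0 (b + 1) _ Hw) as NB.
  rewrite <- (binom_fun_succ b _ Hw).
  set (B := binom_fun (b + 1) (z ^ n)%C) in *.
  replace (1 * ((1 - z ^ n) * B) + z * (b * B * (INR n * z ^ pred n)))%C
    with (B * ((1 - z ^ n) + RtoC (b * INR n) * (z * z ^ pred n)))%C
    by (rewrite RtoC_mult; ring).
  rewrite pow_pred_mult by auto.
  replace (b * INR n) with (2 * (1 - alpha)) by (unfold b; field; apply not_0_INR; lia).
  rewrite !RtoC_mult, !RtoC_minus, !RtoC_mult. field. auto.
Qed.

Lemma extremal_starlike_class (n : nat) (alpha : R) :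
  (1 <= n)%nat -> 0 <= alpha < 1 ->
  class_ST n alpha (extremal_starlike n (2 * (1 - alpha) / INR n)).
Proof.
  intros Hn Ha. split; [|split; [|split]].
  - apply (class_A_of_pow_series n (binom_fun _) _ Hn (eq_refl _ : RtoC (binom_coef _ 0) = RtoC 1)
      (binom_fun_series _)).
  - intros z Hz Nz. apply Cmult_neq_0; auto. apply binom_fun_neq0, disk_pow; auto.
  - apply pseries_analytic with (lacunary n (moebius_coef (1 - 2 * alpha))).
    apply moebius_pow_series; auto. intros z Hz. apply extremal_starlike_zlogder; auto.
  - exists (fun z => z ^ n)%C. split; [apply analytic_pow|]. split.
    + destruct n; [lia|]. simpl. ring.
    + split.
      * intros z Hz. exact (disk_pow z n Hn Hz).
      * intros z Hz. apply extremal_starlike_zlogder; auto.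
Qed.

Lemma extremal_close_class (n : nat) (alpha : R) :
  (1 <= n)%nat -> 0 <= alpha < 1 ->
  class_CS n alpha (extremal_close n (2 * (1 - alpha) / INR n)).
Proof.
  intros Hn Ha. set (b := 2 * (1 - alpha) / INR n). split.
  - apply (class_A_of_pow_series n (fun w => (1 + w) * binom_fun (b + 1) w)%C
      (PS_plus (V := C_NormedModule) (fun k => RtoC (binom_coef (b + 1) k))
        (PS_incr_1 (V := C_NormedModule) (fun k => RtoC (binom_coef (b + 1) k)))) Hn).
    + change (RtoC 1 + RtoC 0 = RtoC 1)%C. ring.
    + intros w Hw. pose proof (binom_fun_series (b + 1) w Hw) as Sb.
      replace ((1 + w) * binom_fun (b + 1) w)%C
        with (binom_fun (b + 1) w + w * binom_fun (b + 1) w)%C by ring.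
      apply (is_pseries_plus (K := C_AbsRing) (V := C_NormedModule)); auto.
      apply (is_pseries_incr_1 (K := C_AbsRing) (V := C_NormedModule)); auto.
  - exists (extremal_starlike n b). split; [apply extremal_starlike_class; auto|].
    set (p := fill1 (fun z => extremal_close n b z / extremal_starlike n b z)%C).
    assert (Ep : forall z, disk 1 z -> p z = ((1 + 1%R * z ^ n) / (1 - z ^ n))%C).
    { intros z Hz. unfold p, fill1. destruct (Ceq_dec z 0) as [->|Nz].
      - destruct n; [lia|]. simpl. field.
      - pose proof (disk_pow z n Hn Hz) as Hw. pose proof (disk1_sub_neq0 _ Hw) as N1.
        pose proof (binom_fun_neq0 (b + 1) _ Hw) as NB.
        unfold extremal_close, extremal_starlike. rewrite <- (binom_fun_succ b _ Hw).
        field. auto. }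
    pose proof (moebius_pow_series n 1 p Hn Ep) as Sp.
    split; [apply (pseries_analytic _ _ Sp)|]. split.
    + exists (lacunary n (moebius_coef 1)). split; [apply lacunary_0; auto|]. split; auto.
      intros k Hk. replace k with (n * 0 + k)%nat by lia. apply lacunary_gap. lia.
    + intros z Hz. rewrite Ep by auto. rewrite Cmult_1_l. apply moebius_Re_pos, disk_pow; auto.
Qed.

(** At a positive point the estimate of [class_CS_zlogder_disk] is attained: the
    value is the rightmost point of that disk. *)
Lemma extremal_close_zlogder (n : nat) (alpha R0 : R) :
  (1 <= n)%nat -> 0 < R0 < 1 ->
  let x := R0 ^ n in
  zlogder (extremal_close n (2 * (1 - alpha) / INR n)) (RtoC R0) =
  RtoC ((1 + 2 * (1 + INR n - alpha) * x + (1 - 2 * alpha) * x ^ 2) / (1 - x ^ 2)).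
Proof.
  intros Hn HR x. set (b := 2 * (1 - alpha) / INR n). set (z := RtoC R0).
  assert (Mz : Cmod z = R0) by (unfold z; rewrite Cmod_R, Rabs_pos_eq; lra).
  assert (Hz : disk 1 z) by (unfold disk; lra).
  assert (Nz : z <> RtoC 0) by (apply Cmod_gt_0; lra).
  pose proof (disk_pow z n Hn Hz) as Hw.
  assert (Hx : 0 < x < 1).
  { split; [apply pow_lt; lra|]. pose proof (disk_pow_lt1 z n Hn Hz) as Q.
    rewrite Mz in Q. exact (proj2 Q). }
  rewrite (zlogder_neq0 _ z (1 * ((1 + z ^ n) * binom_fun (b + 1) (z ^ n))
    + z * ((0 + INR n * z ^ pred n) * binom_fun (b + 1) (z ^ n)
      + (1 + z ^ n) * ((b + 1)%R * binom_fun (b + 1 + 1) (z ^ n) * (INR n * z ^ pred n))))%C); auto.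
  2:{ apply (is_Cderive_mult (fun z => z) (fun z => (1 + z ^ n) * binom_fun (b + 1) (z ^ n))%C);
        [apply is_Cderive_id|].
      apply (is_Cderive_mult (fun z => 1 + z ^ n)%C (fun z => binom_fun (b + 1) (z ^ n))%C).
      - apply (is_Cderive_plus (fun _ => RtoC 1)); [apply is_Cderive_const|apply is_Cderive_pow].
      - apply binom_pow_is_Cderive; auto. }
  unfold extremal_close.
  pose proof (binom_fun_neq0 (b + 1 + 1) _ Hw) as NB.
  rewrite <- (binom_fun_succ (b + 1) _ Hw).
  set (B := binom_fun (b + 1 + 1) (z ^ n)%C) in *.
  assert (Ew : (z ^ n)%C = RtoC x) by (unfold z, x; rewrite RtoC_pow; reflexivity).
  assert (Ez : (z * z ^ pred n)%C = RtoC x) by (rewrite pow_pred_mult by auto; exact Ew).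
  match goal with |- (z * ?d / _)%C = _ =>
    replace d with (B * ((1 + z ^ n) * (1 - z ^ n) + INR n * (z * z ^ pred n) * (1 - z ^ n)
      + (1 + z ^ n) * RtoC ((b + 1) * INR n) * (z * z ^ pred n)))%C
      by (rewrite RtoC_mult; ring) end.
  rewrite Ez, !Ew.
  replace ((b + 1) * INR n) with (2 * (1 - alpha) + INR n)
    by (unfold b; field; apply not_0_INR; lia).
  assert (D1 : (1 + x)%C <> RtoC 0).
  { rewrite <- RtoC_plus. intros A. apply RtoC_inj in A. lra. }
  assert (D2 : (1 - x)%C <> RtoC 0).
  { rewrite <- RtoC_minus. intros A. apply RtoC_inj in A. lra. }
  transitivity (((1 + x) * (1 - x) + INR n * x * (1 - x)
      + (1 + x) * RtoC (2 * (1 - alpha) + INR n) * x) / ((1 + x) * (1 - x)))%C.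
  { field. repeat split; auto. }
  rewrite <- !RtoC_plus, <- !RtoC_minus, <- !RtoC_mult, <- !RtoC_plus.
  rewrite <- RtoC_div by nra. f_equal. field. split; nra.
Qed.

(** * The radius *)

(** The n-th power of the radius, with m in place of n. *)
Definition root_value (alpha m : R) : R :=
  (sqrt 2 - 1) / ((1 + m - alpha) +
     sqrt ((1 + m - alpha) ^ 2 + (1 - 2 * alpha + sqrt 2) * (sqrt 2 - 1))).

Lemma sqrt2_bounds : 1 < sqrt 2 < 2 /\ sqrt 2 ^ 2 = 2.
Proof.
  assert (H : sqrt 2 ^ 2 = 2) by (apply pow2_sqrt; lra).
  pose proof (sqrt_pos 2). split; auto. split; nra.
Qed.

(** The formula is the positive root of A x^2 + 2 B x = sqrt 2 - 1 with the square
    root moved to the denominator. *)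
Lemma root_value_spec (alpha m : R) : 0 <= alpha < 1 -> 1 <= m ->
  let x0 := root_value alpha m in
  0 < x0 < 1 /\
  (1 - 2 * alpha + sqrt 2) * x0 ^ 2 + 2 * (1 + m - alpha) * x0 = sqrt 2 - 1.
Proof.
  intros Ha Hm x0. destruct sqrt2_bounds as (S1 & S2). unfold root_value in x0.
  set (s := sqrt 2) in *.
  set (b := 1 + m - alpha) in *. set (A := 1 - 2 * alpha + s) in *.
  assert (Hb : 1 < b) by (unfold b; lra). assert (HA : 0 < A) by (unfold A; lra).
  assert (D0 : 0 <= b ^ 2 + A * (s - 1)).
  { apply Rplus_le_le_0_compat; [apply pow_le; lra|]. apply Rmult_le_pos; lra. }
  set (q := sqrt (b ^ 2 + A * (s - 1))) in *.
  assert (Hq : q ^ 2 = b ^ 2 + A * (s - 1)) by (apply pow2_sqrt; auto).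
  assert (Pq : 0 <= q) by apply sqrt_pos.
  assert (X : x0 * (b + q) = s - 1) by (unfold x0; field; lra).
  clearbody x0 q s b A.
  assert (P0 : 0 < x0) by nra.
  split; [split; [auto|nra]|].
  apply Rmult_eq_reg_r with ((b + q) ^ 2); [|nra].
  replace ((A * x0 ^ 2 + 2 * b * x0) * (b + q) ^ 2)
    with (A * (x0 * (b + q)) ^ 2 + 2 * b * (x0 * (b + q)) * (b + q)) by ring.
  rewrite X. replace ((b + q) ^ 2) with (b ^ 2 + 2 * b * q + q ^ 2) by ring. rewrite Hq. ring.
Qed.

Lemma pow_lt_base (a b : R) (n : nat) : (1 <= n)%nat -> 0 <= a < b -> a ^ n < b ^ n.
Proof.
  intros Hn H. induction n as [|[|n] IH]; [lia|simpl; lra|].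
  specialize (IH ltac:(lia)). rewrite <- !(tech_pow_Rmult _ (S n)).
  assert (0 <= a ^ S n) by (apply pow_le; lra). nra.
Qed.

Theorem theorem2p3 (n : nat) (alpha : R)
    (hn : (1 <= n)%nat) (halpha : 0 <= alpha < 1) :
  is_SL_radius (class_CS n alpha)
    (Rpower
       ((sqrt 2 - 1) /
        ((1 + INR n - alpha) +
         sqrt ((1 + INR n - alpha) ^ 2
               + (1 - 2 * alpha + sqrt 2) * (sqrt 2 - 1))))
       (1 / INR n)).
Proof.
  change ((sqrt 2 - 1) / _) with (root_value alpha (INR n)).
  assert (Hm : 1 <= INR n) by (change 1 with (INR 1); apply le_INR; auto).
  destruct (root_value_spec alpha (INR n) halpha Hm) as ((X0 & X1) & XE).
  set (x0 := root_value alpha (INR n)) in *. set (R0 := Rpower x0 (1 / INR n)).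
  destruct sqrt2_bounds as (S1 & S2).
  assert (PR : 0 < R0) by apply exp_pos.
  assert (RX : R0 ^ n = x0).
  { rewrite <- Rpower_pow by auto. unfold R0. rewrite Rpower_mult.
    replace (1 / INR n * INR n) with 1 by (field; lra). apply Rpower_1; auto. }
  assert (R1 : R0 < 1).
  { apply Rnot_le_lt. intros L. pose proof (pow_R1_Rle R0 n L). lra. }
  split.
  - split; [lra|]. intros f Hf r Hr z Hz. unfold disk in Hz.
    assert (Hzd : disk 1 z) by (unfold disk; lra).
    unfold SL_at. destruct (Ceq_dec z 0) as [->|Nz].
    { unfold zlogder, fill1. destruct (Ceq_dec 0 0); [|congruence].
      replace (1 ^ 2 - 1)%C with (RtoC 0) by ring. rewrite Cmod_0. lra. }
    pose proof (class_CS_zlogder_disk n alpha f z hn halpha Hf Hzd Nz) as H.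
    set (x := Cmod z ^ n) in H. cbv zeta in H.
    assert (Hx : 0 <= x < x0).
    { rewrite <- RX. pose proof (Cmod_ge_0 z). split; [apply pow_le; auto|].
      unfold x. apply pow_lt_base; auto. lra. }
    assert (Px : 0 < 1 - x ^ 2) by nra.
    assert (Neg : (1 - 2 * alpha + sqrt 2) * x ^ 2 + 2 * (1 + INR n - alpha) * x < sqrt 2 - 1).
    { rewrite <- XE. apply Rplus_le_lt_compat.
      - apply Rmult_le_compat_l; [lra|]. apply pow_incr. lra.
      - apply Rmult_lt_compat_l; lra. }
    set (s := sqrt 2) in *.
    apply (disk_in_lemniscate _ ((1 + (1 - 2 * alpha) * x ^ 2) / (1 - x ^ 2))
             (2 * (1 + INR n - alpha) * x / (1 - x ^ 2))).
    + apply Rmult_le_reg_r with (1 - x ^ 2); auto. unfold Rdiv.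
      rewrite Rmult_assoc, Rinv_l, Rmult_1_r by lra. nra.
    + apply Rmult_le_pos; [|apply Rlt_le, Rinv_0_lt_compat; auto].
      apply Rmult_le_pos; lra.
    + fold s. apply Rmult_lt_reg_r with (1 - x ^ 2); auto.
      replace ((s - (1 + (1 - 2 * alpha) * x ^ 2) / (1 - x ^ 2)) * (1 - x ^ 2))
        with (s * (1 - x ^ 2) - (1 + (1 - 2 * alpha) * x ^ 2)) by (field; lra).
      replace (2 * (1 + INR n - alpha) * x / (1 - x ^ 2) * (1 - x ^ 2))
        with (2 * (1 + INR n - alpha) * x) by (field; lra).
      lra.
    + apply Rmult_le_reg_l with (1 - x ^ 2); auto.
      replace ((1 - x ^ 2) * (2 * (1 + INR n - alpha) * x / (1 - x ^ 2)))
        with (2 * (1 + INR n - alpha) * x) by (field; lra).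
      rewrite <- (Rabs_pos_eq (1 - x ^ 2)) at 1 by lra. rewrite <- Cmod_R, <- Cmod_mult.
      assert (Nx : RtoC (1 - x ^ 2) <> RtoC 0).
      { intros A. apply RtoC_inj in A. lra. }
      replace (RtoC (1 - x ^ 2) * (zlogder f z - RtoC ((1 + (1 - 2 * alpha) * x ^ 2) / (1 - x ^ 2))))%C
        with (RtoC (1 - x ^ 2) * zlogder f z - RtoC (1 + (1 - 2 * alpha) * x ^ 2))%C; auto.
      rewrite RtoC_div by lra. field. auto.
  - intros R1' ((P1 & P2) & Adm). apply Rnot_lt_le. intros L.
    pose proof (Adm _ (extremal_close_class n alpha hn halpha) ((R0 + R1') / 2) ltac:(lra)
      (RtoC R0)) as H.
    assert (Hd : disk ((R0 + R1') / 2) (RtoC R0)).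
    { unfold disk. rewrite Cmod_R, Rabs_pos_eq; lra. }
    specialize (H Hd). unfold SL_at in H.
    rewrite extremal_close_zlogder in H by (auto; lra). rewrite RX in H.
    replace ((1 + 2 * (1 + INR n - alpha) * x0 + (1 - 2 * alpha) * x0 ^ 2) / (1 - x0 ^ 2))
      with (sqrt 2) in H.
    + rewrite <- RtoC_pow, S2, <- RtoC_minus in H.
      rewrite Cmod_R in H. replace (2 - 1) with 1 in H by ring. rewrite Rabs_R1 in H. lra.
    + apply Rmult_eq_reg_r with (1 - x0 ^ 2); [|nra].
      unfold Rdiv. rewrite Rmult_assoc, Rinv_l by nra. lra.
Qed.
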